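(* Let $\alpha$ be a peak composition of $n$. Let $C$ be the $\sim_D$-equivalence class of $[\mathrm w_{LT}(\mathcal T''_\alpha),w_1(\mathrm{set}(\alpha^{r}))]_L$ and let $\mathscr G:=D(\mathbf Q^{r}_\alpha,\mathrm w_{LT})$. (a) $C=\{\Sigma_L(P_{T^x}):T\in\mathsf{ST}(\mathscr G^x)\}$. Furthermore, $$\min C=[w_0(2[\ell(\alpha)-1]),\mathrm w_{dr}(\mathcal T_\alpha)]_L\quad\text{and}\quad\max C=[\mathrm w_{LT}(\mathcal T''_\alpha),w_1(\mathrm{set}(\alpha^{r}))]_L .$$ (b) $(C,\preceq)\cong(\mathsf{ST}(\mathscr G^x),\trianglelefteq)$ as posets.
   Context: Permutations. $n$ is a positive integer, $[n]=\{1,\dots,n\}$, $\mathfrak S_n$ the symmetric group (product = composition of maps; permutations written as words), $s_i=(i,i+1)$, $\ell(\sigma)$ Coxeter length, $w_0$ the longest element. $\mathrm{Des}_L(\sigma)=\{i:\ell(s_i\sigma)<\ell(\sigma)\}$, $\mathrm{Des}_R(\sigma)=\{i:\ell(\sigma s_i)<\ell(\sigma)\}$. $\preceq_L$ (resp. $\preceq_R$) has covers $\sigma\prec s_i\sigma$, $i\notin\mathrm{Des}_L(\sigma)$ (resp. $\sigma\prec\sigma s_i$, $i\notin\mathrm{Des}_R(\sigma)$); $[\sigma,\rho]_L$ is the interval for $\preceq_L$. For $S\subseteq[n-1]$, $S^{c}=[n-1]\setminus S$; $w_0(S)$ is the longest element of the subgroup generated by $\{s_i:i\in S\}$; $w_1(S)=w_0w_0(S^c)$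 is the longest element of $\{z:\mathrm{Des}_R(z)\subseteq S\}$. $2[k]=\{2,4,\dots,2k\}$, $2[0]=\emptyset$. For a composition $\alpha=(\alpha_1,\dots,\alpha_l)$ of $n$, $\ell(\alpha)=l$, $\mathrm{set}(\alpha)=\{\alpha_1,\dots,\alpha_1+\dots+\alpha_{l-1}\}$, $\alpha^r=(\alpha_l,\dots,\alpha_1)$. $\alpha$ is a peak composition if $\alpha_i\ne1$ for $1\le i<\ell(\alpha)$. Classes. For nonempty left weak Bruhat intervals, $I_1\sim_D I_2$ iff there is a poset isomorphism $f:(I_1,\preceq_L)\to(I_2,\preceq_L)$ with $\mathrm{Des}_L(f(\gamma))=\mathrm{Des}_L(\gamma)$ for all $\gamma$. On a class $C$ put $[\sigma,\rho]_L\preceq[\sigma',\rho']_L$ iff $\sigma\preceq_R\sigma'$; it is known that $(C,\preceq)$ has a minimum and a maximum. Diagrams and fillings. Boxes are $(x,y)\in\mathbb Z_{>0}^2$ with $x$ = column from the left, $y$ = row from the bottom. For a diagram $D$ with $n$ boxes and no empty rows/columns, a standard filling is a bijection $F:D\to[n]$; $P_F$ is the poset on $[n]$ with $i\preceq j$ iff $x_i\le x_j$ and $y_i\le y_j$, where $(x_i,y_i)=F^{-1}(i)$; $\Sigma_L(P)=\{\sigma\in\mathfrak S_n:\sigma(i)\le\sigma(j)\text{ whenever }i\preceq_Pj\}$. $\mathsf{ST}(D)$: standard fillings $T$ with $T(i,j)\le T(k,l)$ whenever $i\le k$, $j\le l$, ordered by $T\trianglelefteq U$ iff $\mathrm w_{TL}(T)\preceq_L\mathrm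 w_{TL}(U)$, where $\mathrm w_{TL}$ reads each column top to bottom, leftmost column first. $D^x$, $T^x$: reflection across the $x$-axis (shifted upward to the first quadrant, touching the axes). $\mathrm w_{LT}$ reads each row left to right, top row first. Tableaux of shape $\mathrm{tcd}(\alpha)=\{(j,i):1\le i\le\ell(\alpha),1\le j\le\alpha_i\}$. $\mathcal T_\alpha$ is filled with $1,\dots,n$ along rows left to right, bottom row first. $\mathcal T''_\alpha$ has in column $1$, from bottom to top, the first $\ell(\alpha)$ odd numbers; in column $2$, from bottom to top, the first $\ell(\alpha)-1$ or $\ell(\alpha)$ even numbers (according to whether or not $\alpha_{\ell(\alpha)}=1$); and the remaining numbers are placed increasingly, left to right in each row, in the remaining boxes, top row first. For a filling $\mathcal T$ of $\mathrm{tcd}(\alpha)$, $\mathrm w_{dr}(\mathcal T)$ reads first $\mathcal T(1,1)$, then $\mathcal T(1,j),\mathcal T(2,j-1)$ for $j=2,\dots,\ell(\alpha)$ in order, and then the remaining entries of each row left to right, from the top row to the bottom row. $D(\mathbf Q^r_\alpha,\mathrm w_{LT})$ is the diagram whose $j$th row from the bottom ($1\le j\le\ell(\alpha)$) is $\{(j+x-1,j):1\le x\le\alpha_{\ell(\alpha)}\}$ if $j=\ell(\alpha)$, and $\{(j,j),(j+1,j)\}\cup\{(k_j+x,j):3\le x\le\alpha_j\}$ if $j<\ell(\alpha)$, where $k_j=(\ell(\alpha)-1)+\sum_{j<r\le\ell(\alpha)}(\alpha_r-2)$. *)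

(* Defs.v *)
From mathcomp Require Import all_boot all_order all_fingroup.
From mathcomp Require Import finmap.

Set Implicit Arguments.
Unset Strict Implicit.
Unset Printing Implicit Defensive.

(* Conventions.
   - [n] = {1, ..., n} is 'I_n: i : 'I_n stands for the element i.+1 of [n].
   - Labels of simple reflections are NOT shifted: [n-1] is the set of the
     i : 'I_n with 0 < i, and s_i exchanges the elements i and i.+1 of [n],
     i.e. the ordinals i.-1 and i.
   - Words of permutations and entries of fillings are natural numbers, with
     their true values 1, ..., n.
   - MathComp multiplies permutations from left to right; products of
     permutations below are written with [pcomp], composition of maps. *)

Section Permutations.
Variable n : nat.
Implicit Types (s t : 'S_n) (S : {set 'I_n}) (I : {set 'S_n}).

Definition pcomp s t : 'S_n := (t * s)%g.

Definition srefl (i : 'I_n) : 'S_n := tperm (ord_pred i) i.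

Definition has_expr s (k : nat) : bool :=
  [exists w : k.-tuple 'I_n,
     all (fun i : 'I_n => 0 < i) w && (\big[pcomp/1%g]_(i <- w) srefl i == s)].

Lemma tperm_gen_srefl (x y : 'I_n) :
  tperm x y \in << [set srefl i | i : 'I_n & 0 < i] >>%g.
Proof.
wlog lexy : x y / x <= y => [H|].
  by case/orP: (leq_total x y) => /H // Hxy; rewrite tpermC.
move: {2}(y : nat) (erefl (y : nat)) => m; elim: m y lexy => [|m IHm] y lexy ym.
  suff -> : x = y by rewrite tperm1 group1.
  by apply: val_inj => /=; apply/eqP; move: lexy; rewrite ym leqn0 => /eqP->.
have [->|neq_xy] := eqVneq x y; first by rewrite tperm1 group1.
have ltxy : x < y by rewrite ltn_neqAle lexy andbT.
have yp : ord_pred y = m :> nat.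
  rewrite /= ym addSn /= -modnDmr modnn addn0 modn_small //.
  by apply: ltn_trans (ltn_ord y); rewrite ym.
have Sy : srefl y \in << [set srefl i | i : 'I_n & 0 < i] >>%g.
  by apply/mem_gen/imset_f; rewrite inE ym.
have [->|neq_xp] := eqVneq x (ord_pred y); first exact: Sy.
have Hx : tperm x (ord_pred y) \in << [set srefl i | i : 'I_n & 0 < i] >>%g.
  by apply: IHm => //; rewrite yp -ltnS -ym.
suff -> : tperm x y = (tperm x (ord_pred y) ^ srefl y)%g by rewrite groupJ.
by rewrite /srefl tpermJ tpermL tpermD // eq_sym.
Qed.

Lemma has_exprP s : exists k, has_expr s k.
Proof.
have : s \in << [set srefl i | i : 'I_n & 0 < i] >>%g.
  have [ts -> _] := prod_tpermP s.
  by apply: group_prod => i _; apply: tperm_gen_srefl.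
case/gen_prodgP=> m [c cS ->].
suff [w w_gt0 wE] : exists2 w : seq 'I_n, all (fun i : 'I_n => 0 < i) w &
    \big[pcomp/1%g]_(i <- w) srefl i = (\prod_(i < m) c i)%g.
  by exists (size w); apply/existsP; exists (in_tuple w); rewrite w_gt0 wE eqxx.
elim: m c cS => [|m IHm] c cS; first by exists [::]; rewrite // big_ord0 big_nil.
have [w w_gt0 wE] := IHm (fun i => c (widen_ord (leqnSn m) i)) (fun i => cS _).
have /imsetP[i] := cS ord_max; rewrite inE => i_gt0 ci.
by exists (i :: w); rewrite /= ?i_gt0 // big_cons wE big_ord_recr /= ci.
Qed.

Definition coxlen s : nat := ex_minn (has_exprP s).

Definition DesL s : {set 'I_n} :=
  [set i : 'I_n | (0 < i) && (coxlen (pcomp (srefl i) s) < coxlen s)].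

Definition DesR s : {set 'I_n} :=
  [set i : 'I_n | (0 < i) && (coxlen (pcomp s (srefl i)) < coxlen s)].

Definition coverL : rel 'S_n := fun s t =>
  [exists i : 'I_n, [&& 0 < i, i \notin DesL s & t == pcomp (srefl i) s]].

Definition coverR : rel 'S_n := fun s t =>
  [exists i : 'I_n, [&& 0 < i, i \notin DesR s & t == pcomp s (srefl i)]].

Definition leL : rel 'S_n := connect coverL.

Definition leR : rel 'S_n := connect coverR.

Definition intL s t : {set 'S_n} := [set u | leL s u && leL u t].

Definition labels : {set 'I_n} := [set i : 'I_n | 0 < i].

Definition parabolic S : {set 'S_n} := << [set srefl i | i in S] >>%g.

Definition w0 S : 'S_n := [arg max_(s > 1%g in parabolic S) coxlen s].

Definition w1 S : 'S_n := pcomp (w0 labels) (w0 (labels :\: S)).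

(* 2[k] = {2, 4, ..., 2k}, as a set of labels *)
Definition evens (k : nat) : {set 'I_n} :=
  [set i : 'I_n | [&& 0 < i, ~~ odd i & i <= k.*2]].

Definition word s : seq nat := [seq (s i).+1 | i <- enum 'I_n].

(* The permutation with a given word (the identity if there is none). *)
Definition perm_of_word (w : seq nat) : 'S_n :=
  odflt 1%g [pick s : 'S_n | word s == w].

Definition SigmaL (P : rel 'I_n) : {set 'S_n} :=
  [set s : 'S_n | [forall i, forall j, P i j ==> (s i <= s j)]].

End Permutations.

Definition poset_iso (A B : Type) (P : A -> Prop) (leA : A -> A -> Prop)
    (Q : B -> Prop) (leB : B -> B -> Prop) (f : A -> B) : Prop :=
  [/\ forall x, P x -> Q (f x),
      forall x y, P x -> P y -> f x = f y -> x = y,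
      forall y, Q y -> exists2 x, P x & f x = y
    & forall x y, P x -> P y -> (leA x y <-> leB (f x) (f y))].

Definition is_min (A : Type) (le : A -> A -> Prop) (P : A -> Prop) (x : A) :=
  P x /\ forall y, P y -> le x y.

Definition is_max (A : Type) (le : A -> A -> Prop) (P : A -> Prop) (x : A) :=
  P x /\ forall y, P y -> le y x.

Section Classes.
Variable n : nat.
Implicit Types I J : {set 'S_n}.

Definition is_intL I : Prop := exists s t : 'S_n, leL s t /\ I = intL s t.

Definition equivD I J : Prop :=
  exists2 f : 'S_n -> 'S_n,
    poset_iso (fun u => u \in I) (@leL n) (fun u => u \in J) (@leL n) f
    & forall u, u \in I -> DesL (f u) = DesL u.

Definition classD I J : Prop := is_intL J /\ equivD I J.

(* Nonempty intervals are sets of permutations; their end points are recovered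
   existentially (they are unique, leL being antisymmetric). *)
Definition le_int I J : Prop :=
  exists s t s' t' : 'S_n,
    [/\ leL s t /\ I = intL s t, leL s' t' /\ J = intL s' t' & leR s s'].

End Classes.

(* (x, y) is the box in column x (from the left) and row y (from the bottom);
   columns and rows are numbered from 1. *)
Definition box := (nat * nat)%type.
Definition diagram := {fset box}.

(* A filling of D is extended by 0 outside D: since entries are positive, D is
   the support of the filling. *)
Definition filling := {fsfun box -> nat with 0}.

Definition height (D : diagram) : nat := \max_(b <- D) b.2.

Definition flip_box (h : nat) (b : box) : box := (b.1, h.+1 - b.2).

Definition flip_diagram (D : diagram) : diagram :=
  [fset flip_box (height D) b | b in D]%fset.

Definition flip_filling (F : filling) : filling :=
  [fsfun b in flip_diagram (finsupp F) => F (flip_box (height (finsupp F)) b)].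

Definition std_filling (D : diagram) (F : filling) : Prop :=
  finsupp F = D /\ perm_eq [seq F b | b <- D] (iota 1 #|` D|).

Definition ST (D : diagram) (T : filling) : Prop :=
  std_filling D T /\
  forall b c, b \in D -> c \in D -> b.1 <= c.1 -> b.2 <= c.2 -> T b <= T c.

(* Reading orders: TL reads each column from top to bottom, leftmost column
   first; LT reads each row from left to right, top row first. *)
Definition orderTL : rel box := fun b c =>
  (b.1 < c.1) || (b.1 == c.1) && (c.2 <= b.2).

Definition orderLT : rel box := fun b c =>
  (c.2 < b.2) || (b.2 == c.2) && (b.1 <= c.1).

Definition wTL (F : filling) : seq nat :=
  [seq F b | b <- sort orderTL (finsupp F)].

Definition wLT (F : filling) : seq nat :=
  [seq F b | b <- sort orderLT (finsupp F)].

Definition box_of (F : filling) (k : nat) : box :=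
  nth (0, 0) (finsupp F) (index k [seq F b | b <- finsupp F]).

Definition poset_of n (F : filling) : rel 'I_n := fun i j =>
  ((box_of F i.+1).1 <= (box_of F j.+1).1) &&
  ((box_of F i.+1).2 <= (box_of F j.+1).2).

Definition le_ST n (T U : filling) : Prop :=
  leL (perm_of_word n (wTL T)) (perm_of_word n (wTL U)).

Definition composition (n : nat) (a : seq nat) : Prop :=
  0 \notin a /\ sumn a = n.

(* The i-th part of a, for 1 <= i <= size a. *)
Definition part (a : seq nat) (i : nat) : nat := nth 0 a i.-1.

Definition peak (a : seq nat) : Prop :=
  forall i, 1 <= i < size a -> part a i != 1.

Definition set_of_comp n (a : seq nat) : {set 'I_n} :=
  [set i : 'I_n | val i \in [seq sumn (take k a) | k <- iota 1 (size a).-1]].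

Definition tcd_seq (a : seq nat) : seq box :=
  [seq (j, i) | i <- iota 1 (size a), j <- iota 1 (part a i)].

Definition tcd (a : seq nat) : diagram := [fset b in tcd_seq a]%fset.

Definition calT (a : seq nat) : filling :=
  [fsfun b in tcd a => sumn (take b.2.-1 a) + b.1].

Definition rest_boxes (a : seq nat) : seq box :=
  sort orderLT [seq b <- tcd_seq a | 2 < b.1].

(* The first two columns contain exactly the numbers 1, ..., 2l or, if the last
   part is 1, the numbers 1, ..., 2l-1. *)
Definition calT'' (a : seq nat) : filling :=
  [fsfun b in tcd a =>
     if b.1 == 1 then b.2.*2.-1
     else if b.1 == 2 then b.2.*2
     else (size a).*2 - (part a (size a) == 1) + (index b (rest_boxes a)).+1].

Definition dr_head (a : seq nat) : seq box :=
  (1, 1) :: flatten [seq [:: (1, j); (2, j.-1)] | j <- iota 2 (size a).-1].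

Definition wdr (a : seq nat) (F : filling) : seq nat :=
  [seq F b | b <- dr_head a ++
     [seq b <- sort orderLT (tcd a) | b \notin dr_head a]].

(* k_j = (l - 1) + sum_(j < r <= l) (a_r - 2), computed without truncation: for
   j < l, only the last term of the sum can be negative, and then it is -1. *)
Definition kj (a : seq nat) (j : nat) : nat :=
  ((size a).-1 + \sum_(j.+1 <= r < (size a).+1) part a r) - (size a - j).*2.

Definition rowG (a : seq nat) (j : nat) : seq box :=
  if j == size a then [seq (j + x - 1, j) | x <- iota 1 (part a j)]
  else [:: (j, j); (j.+1, j)] ++
       [seq (kj a j + x, j) | x <- iota 3 (part a j - 2)].

Definition scrG (a : seq nat) : diagram :=
  [fset b in flatten [seq rowG a j | j <- iota 1 (size a)]]%fset.

(* Main.v *)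
(* Going up a cover of the left weak order creates exactly one new left descent,
   the label of the cover. Hence a descent-preserving isomorphism of intervals
   preserves the labels of covers, so it is a right translation.

   For two distinct boxes of a diagram, compare them by the north-east order (NE)
   and by the south-east order (SE): boxes that are not comparable for one of them
   are comparable for the other one. If T is an SE-linear extension, the NE-linear
   extensions, read as words in the order of T, form the left weak interval whose
   ends are the readings of the column filling and of the row filling. Translating
   it to another interval amounts to changing T into some filling U. The order of
   two boxes in U is then forced to be SE: in a row, by the descents of the maximum
   (where row neighbours have consecutive values), in a column, by the descents of
   the minimum, and for strictly SE boxes because the minimum is below the maximum.
   Conversely every SE-linear extension U gives an interval equivalent to that
   of T, because the NE covers of scrG alpha join boxes of one row or one column,
   which T and U order in the same way. So the class is isomorphic to the poset of
   SE-linear extensions, whose extreme elements read scrG alpha by columns and by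
   rows. *)

Require Import Defs.
From mathcomp Require Import all_boot all_order all_fingroup.
From mathcomp Require Import finmap.
From mathcomp Require Import zify.

Set Implicit Arguments.
Unset Strict Implicit.
Unset Printing Implicit Defensive.

(* [pcomp] alone is hidden by the composition of partial functions of ssrfun. *)
Local Notation pcomp := Defs.pcomp.

(** * Coxeter length and the weak orders through inversions *)

Section Inversions.
Variable n : nat.
Implicit Types (s t u : 'S_n) (i j : 'I_n) (S : {set 'I_n}).

(** Inversions are pairs of positions: left multiplication by [srefl i] exchanges two adjacent
    values, so it changes this set by a single pair. *)
Definition inversions s : {set 'I_n * 'I_n} :=
  [set p : 'I_n * 'I_n | (p.1 < p.2) && (s p.2 < s p.1)].

Lemma inversionsE s i j : ((i, j) \in inversions s) = (i < j) && (s j < s i).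
Proof. by rewrite inE. Qed.

Lemma inversionsP s i j : i < j -> ((i, j) \in inversions s) = (s j < s i).
Proof. by rewrite inE /= => ->. Qed.

Lemma pcompE s t i : pcomp s t i = s (t i).
Proof. by rewrite permM. Qed.

Lemma pred_ordE i : 0 < i -> ord_pred i = i.-1 :> nat.
Proof.
move=> i_gt0 /=; have i_lt := ltn_ord i.
have -> : (i + n).-1 = i.-1 + n by lia.
by rewrite modnDr modn_small //; lia.
Qed.

Lemma sreflE i j : 0 < i ->
  srefl i j = (if j == i.-1 :> nat then i : nat
               else if j == i :> nat then i.-1 else j) :> nat.
Proof.
move=> i_gt0; have pE := pred_ordE i_gt0; rewrite /srefl.
case: tpermP => [->|->|ne1 ne2]; first by rewrite pE eqxx.
  by rewrite eqxx pE; case: ifP => // /eqP; lia.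
case: eqP => [E|_]; first by case: ne1; apply: ord_inj; rewrite E pE.
by case: eqP => // /ord_inj.
Qed.

(** This extends relations checked on consecutive ordinals, typically descents, to arbitrary
    pairs. *)
Lemma ord_chain (R : rel 'I_n) i j : transitive R -> i < j ->
  (forall k : 'I_n, i < k <= j -> R (ord_pred k) k) -> R i j.
Proof.
move=> R_tr; case: j => m; elim: m => [|m IHm] lt_m //= lt_im step.
have predE : ord_pred (Ordinal lt_m) = Ordinal (ltnW lt_m).
  by apply: ord_inj; rewrite pred_ordE.
have := step (Ordinal lt_m); rewrite lt_im leqnn predE => /(_ isT) Rm.
move: lt_im; rewrite ltnS leq_eqVlt => /orP[/eqP iE|lt_im].
  by rewrite (_ : i = Ordinal (ltnW lt_m)) //; apply: ord_inj.
apply: R_tr Rm; apply: IHm => // k /andP[lt_ik le_km].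
by apply: step; rewrite lt_ik /= ltnW.
Qed.

Lemma srefl_inv i : ((srefl i)^-1 = srefl i)%g.
Proof. exact: tpermV. Qed.

Lemma pcomp_sreflK i s : pcomp (srefl i) (pcomp (srefl i) s) = s.
Proof. by rewrite /pcomp -mulgA tperm2 mulg1. Qed.

Lemma pcomp_inv s t : ((pcomp s t)^-1 = pcomp t^-1 s^-1)%g.
Proof. by rewrite /pcomp invMg. Qed.

Lemma inversions_srefl s i : 0 < i -> (s^-1)%g (ord_pred i) < (s^-1)%g i ->
  inversions (pcomp (srefl i) s) =
    ((s^-1)%g (ord_pred i), (s^-1)%g i) |: inversions s.
Proof.
move=> i_gt0 lt_ab; set a := (s^-1)%g (ord_pred i); set b := (s^-1)%g i.
have sa : s a = i.-1 :> nat by rewrite permKV pred_ordE.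
have sb : s b = i :> nat by rewrite permKV.
apply/setP => -[x y]; rewrite in_setU1 !inversionsE.
have [/= lt_xy|ge_xy] := ltnP x y; last first.
  rewrite orbF; apply/esym/negbTE/eqP => -[xa yb].
  by move: ge_xy; rewrite xa yb leqNgt lt_ab.
rewrite !pcompE !sreflE // -sa -sb.
have E z w : (s z == s w :> nat) = (z == w) by rewrite val_eqE (inj_eq perm_inj).
rewrite !E xpair_eqE.
have neq z w : z != w -> s z <> s w :> nat by rewrite -E => /eqP.
have sab : (s a).+1 = s b by rewrite sa sb; lia.
have [->|xa] := eqVneq x a; have [yb|yb] := eqVneq y b; rewrite /= ?orbF.
- by rewrite yb; case: eqP => [ba|_]; [move: sab; rewrite ba|]; lia.
- have [ya|ya] := eqVneq y a; first by rewrite ya; lia.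
  have /neq := yb; have /neq := ya; lia.
- have [ya|_] := eqVneq y a; first by move: lt_ab; rewrite -/a -/b -ya -yb ltnn.
  have [xb|xb] := eqVneq x b; first by move: lt_xy; rewrite yb xb ltnn.
  have /neq := xb; have /neq := xa; rewrite yb; lia.
have [ya|ya] := eqVneq y a; have [xb|xb] := eqVneq x b => //.
- by move: lt_xy; rewrite ya xb ltnNge ltnW.
- have /neq := xb; have /neq := xa; rewrite ya; lia.
- have /neq := yb; have /neq := ya; rewrite xb; lia.
Qed.

Lemma card_inversions_srefl s i : 0 < i -> (s^-1)%g (ord_pred i) < (s^-1)%g i ->
  #|inversions (pcomp (srefl i) s)| = #|inversions s|.+1.
Proof.
move=> i_gt0 lt_ab; rewrite inversions_srefl // cardsU1 inversionsE lt_ab /=.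
by rewrite !permKV pred_ordE // ltnNge leq_pred add1n.
Qed.

Lemma ord_predP s i : 0 < i ->
  (s (ord_pred i) < s i) || (s i < s (ord_pred i)).
Proof.
move=> i_gt0; rewrite -neq_ltn; apply/eqP => /val_inj/perm_inj E.
by move: (pred_ordE i_gt0); rewrite E; lia.
Qed.

Lemma card_inversions_srefl_desc s i : 0 < i ->
    (s^-1)%g i < (s^-1)%g (ord_pred i) ->
  #|inversions s| = #|inversions (pcomp (srefl i) s)|.+1.
Proof.
move=> i_gt0 gt_ab; rewrite -{1}(pcomp_sreflK i s) card_inversions_srefl //.
by rewrite pcomp_inv !pcompE srefl_inv /srefl tpermL tpermR.
Qed.

(** An increasing permutation moves no element down, and the same holds for its inverse. *)
Lemma homo_perm1 s : (forall i j, i < j -> s i < s j) -> s = 1%g.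
Proof.
move=> hs; apply/permP => i; rewrite perm1; apply/val_inj => /=.
have ge (t : 'S_n) : (forall i j, i < j -> t i < t j) -> forall k : 'I_n, k <= t k.
  move=> ht k; case: k => m; elim: m => [|m IHm] lt_m //=.
  have lt_m' := ltnW lt_m; apply: leq_ltn_trans (IHm lt_m') _.
  exact: ht.
have hs' (x y : 'I_n) : x < y -> (s^-1)%g x < (s^-1)%g y.
  move=> lt_xy; rewrite ltnNge leq_eqVlt; apply/negP => /orP[/eqP E|].
    by move/val_inj/perm_inj: E lt_xy => ->; rewrite ltnn.
  by move/hs; rewrite !permKV => lt_yx; move: (ltn_trans lt_xy lt_yx); rewrite ltnn.
by apply/eqP; rewrite eqn_leq ge // andbT; have := ge _ hs' (s i); rewrite permK.
Qed.

Lemma ex_descent s : s != 1%g -> exists2 i : 'I_n, 0 < i & s i < s (ord_pred i).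
Proof.
move=> s1; have [/existsP[i /andP[i_gt0 lt_s]]|] :=
  boolP [exists i : 'I_n, (0 < i) && (s i < s (ord_pred i))]; first by exists i.
rewrite negb_exists => /forallP nd; case/eqP: s1; apply: homo_perm1.
have step (i : 'I_n) : 0 < i -> s (ord_pred i) < s i.
  by move=> i_gt0; have := nd i; have := ord_predP s i_gt0; rewrite i_gt0 /=; lia.
move=> i j; case: j => m; elim: m => [|m IHm] lt_m //=; rewrite ltnS leq_eqVlt.
have E : ord_pred (Ordinal lt_m) = Ordinal (ltnW lt_m).
  by apply: ord_inj; rewrite pred_ordE.
have := step (Ordinal lt_m) isT; rewrite E => lt_s.
case/orP=> [/eqP iE|lt_im]; last exact: ltn_trans (IHm _ lt_im) lt_s.
by rewrite (_ : i = Ordinal (ltnW lt_m)) //; apply: val_inj.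
Qed.

Lemma inversions1 : inversions 1%g = set0.
Proof. by apply/setP => -[i j]; rewrite inversionsE in_set0 !perm1; lia. Qed.

Lemma has_exprE s (k : nat) : reflect
  (exists w : seq 'I_n, [/\ size w = k, all (fun i : 'I_n => 0 < i) w &
     \big[@pcomp n/1%g]_(i <- w) srefl i = s]) (has_expr s k).
Proof.
apply: (iffP existsP) => [[w /andP[w_gt0 /eqP wE]]|[w [ws w_gt0 wE]]].
  by exists w; rewrite size_tuple.
by move/eqP: ws => ws; exists (Tuple ws); rewrite /= w_gt0 wE eqxx.
Qed.

(** Left multiplication by a descent removes exactly one inversion; repeated down to the identity,
    it spells an expression with one letter per inversion. *)
Lemma has_expr_inversions s : has_expr s #|inversions s|.
Proof.
have [m] := ubnP #|inversions s|; elim: m s => // m IHm s lt_m.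
have [->|s1] := eqVneq s 1%g.
  by apply/has_exprE; exists [::]; rewrite inversions1 cards0 big_nil.
have [|i i_gt0 di] := @ex_descent s^-1; first by rewrite invg_eq1.
have cE := card_inversions_srefl_desc i_gt0 di.
have /IHm/has_exprE[w [ws w_gt0 wE]] : #|inversions (pcomp (srefl i) s)| < m.
  by rewrite -ltnS -cE.
apply/has_exprE; exists (i :: w); rewrite /= ws cE i_gt0 w_gt0.
by rewrite big_cons wE pcomp_sreflK.
Qed.

Lemma coxlenE s : coxlen s = #|inversions s|.
Proof.
rewrite /coxlen; case: ex_minnP => m /has_exprE[w [<- w_gt0 <-]] min_m.
apply/eqP; rewrite eqn_leq min_m ?has_expr_inversions //= {min_m}.
(* Each letter adds or removes one inversion, so no expression is shorter than the number of
   inversions. *)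
elim: w w_gt0 => [|i w IHw] /=; first by rewrite big_nil inversions1 cards0.
case/andP=> i_gt0 /IHw lew; rewrite big_cons; set u := \big[_/_]_(_ <- w) _ in lew *.
case/orP: (ord_predP u^-1 i_gt0) => [lt|gt]; first by rewrite card_inversions_srefl.
by apply: leqW (leq_trans _ lew); rewrite [leqRHS](card_inversions_srefl_desc i_gt0 gt).
Qed.

Lemma in_DesL s i :
  (i \in DesL s) = (0 < i) && ((s^-1)%g i < (s^-1)%g (ord_pred i)).
Proof.
rewrite inE; case: ltnP => //= i_gt0; rewrite !coxlenE.
case/orP: (ord_predP s^-1 i_gt0) => [lt|gt].
  by rewrite card_inversions_srefl //; lia.
by rewrite gt (card_inversions_srefl_desc i_gt0 gt); lia.
Qed.

(** The map from (x, y) to (t y, t x) carries the inversions of [t] injectively to those of its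
    inverse. *)
Lemma card_inversionsV s : #|inversions s^-1| = #|inversions s|.
Proof.
have le t : #|inversions t| <= #|inversions t^-1|.
  have inj : injective (fun p : 'I_n * 'I_n => (t p.2, t p.1)).
    by move=> [x y] [z w] [/perm_inj -> /perm_inj ->].
  rewrite -(card_imset (mem (inversions t)) inj).
  apply/subset_leq_card/subsetP => _ /imsetP[[x y] xy ->]; move: xy.
  by rewrite !inversionsE /= !permK andbC.
by apply/eqP; rewrite eqn_leq le -{2}(invgK s) le.
Qed.

Lemma coxlenV s : coxlen s^-1 = coxlen s.
Proof. by rewrite !coxlenE card_inversionsV. Qed.

Lemma DesR_V s : DesR s = DesL s^-1.
Proof.
by apply/setP => i; rewrite !inE -coxlenV pcomp_inv srefl_inv coxlenV.
Qed.

Lemma coverLP s t : reflect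
  (exists i : 'I_n, [/\ 0 < i, (s^-1)%g (ord_pred i) < (s^-1)%g i
                & t = pcomp (srefl i) s])
  (coverL s t).
Proof.
apply: (iffP existsP) => -[i].
  case/and3P=> i_gt0; rewrite in_DesL i_gt0 => /= nd /eqP ->; exists i; split=> //.
  by have := ord_predP s^-1 i_gt0; rewrite (negPf nd) orbF.
case=> i_gt0 lt ->; exists i; rewrite i_gt0 eqxx in_DesL i_gt0 /=; lia.
Qed.

Lemma leLP s t : reflect (inversions s \subset inversions t) (leL s t).
Proof.
apply: (iffP idP).
  case/connectP=> p; elim: p s => [|u p IHp] s /=; first by move=> _ ->.
  case/andP=> /coverLP[i [i_gt0 lt uE]] pth tE.
  apply: subset_trans (IHp _ pth tE); rewrite uE inversions_srefl //.
  exact: subsetUr.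
have [m] := ubnP (#|inversions t| - #|inversions s|).
elim: m s => // m IHm s lt_m sub.
have [E|ne] := eqVneq (pcomp t s^-1) 1%g.
  suff -> : t = s by exact: connect0.
  by move: E; rewrite /pcomp => /(congr1 (mulg s)); rewrite mulKVg mulg1.
(* A descent of [pcomp t s^-1] gives adjacent values of [s] at positions [a] and [b] that [t]
   inverts and [s] does not, so the cover of [s] with this label stays below [t]. *)
have [i i_gt0] := ex_descent ne; rewrite !pcompE.
set a := (s^-1)%g (ord_pred i); set b := (s^-1)%g i => lt_t.
have lt_ab : a < b.
  case/orP: (ord_predP s^-1 i_gt0) => // lt_ba.
  have /(subsetP sub) : (b, a) \in inversions s.
    rewrite inversionsE !permKV pred_ordE //; apply/andP; split; first exact: lt_ba.
    by rewrite ltn_predL.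
  by rewrite inversionsE; lia.
have abt : (a, b) \in inversions t by rewrite inversionsE lt_ab.
apply: (@connect_trans _ _ (pcomp (srefl i) s)).
  by apply/connect1/coverLP; exists i.
have sub' : inversions (pcomp (srefl i) s) \subset inversions t.
  by rewrite inversions_srefl // subUset sub1set abt.
apply: (IHm _ _ sub'); rewrite card_inversions_srefl //.
have := subset_leq_card sub'; rewrite card_inversions_srefl //.
by move: lt_m; rewrite -/a -/b; lia.
Qed.

Lemma inversions_inj : injective inversions.
Proof.
move=> s t E.
have /leLP/connectP[p pth tE] : inversions s \subset inversions t by rewrite E.
case: p pth tE => [|u p] /=; first by move=> _ ->.
case/andP=> /coverLP[i [i_gt0 lt uE]] pth tE.
have /leLP/subset_leq_card : leL u t by apply/connectP; exists p.
by rewrite -E uE card_inversions_srefl // ltnn.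
Qed.

Lemma leL_refl s : leL s s. Proof. exact: connect0. Qed.

Lemma leL_trans : transitive (@leL n).
Proof. by move=> u s t; apply: connect_trans. Qed.

Lemma leL_anti s t : leL s t -> leL t s -> s = t.
Proof.
by move=> /leLP st /leLP ts; apply/inversions_inj/eqP; rewrite eqEsubset st.
Qed.

(** Inverting permutations exchanges left and right covers, so [leR] can be tested on inversions
    too. *)
Lemma leRV s t : leR s t = leL (s^-1)%g (t^-1)%g.
Proof.
have cV (u v : 'S_n) : coverR u v = coverL (u^-1)%g (v^-1)%g.
  apply: eq_existsb => i; rewrite DesR_V; case: (0 < i) => //=.
  case: (i \notin _) => //=.
  by rewrite -(inj_eq invg_inj) pcomp_inv srefl_inv.
have LR (u v : 'S_n) : leL u v -> leR (u^-1)%g (v^-1)%g.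
  case/connectP=> p; elim: p u => [|w p IHp] u /= => [_ ->|]; first exact: connect0.
  case/andP=> uw pth vE; apply: (connect_trans _ (IHp _ pth vE)).
  by apply: connect1; rewrite cV !invgK.
apply/idP/idP => [|/LR]; last by rewrite !invgK.
case/connectP=> p; elim: p s => [|u p IHp] s /= => [_ ->|]; first exact: leL_refl.
case/andP=> su pth tE; apply: (leL_trans _ (IHp _ pth tE)).
by apply: connect1; rewrite -cV.
Qed.

End Inversions.

(** * Inversions of the longest elements w0(S) and w1(S) *)

Section LongestElements.
Variable n : nat.
Implicit Types (s t u : 'S_n) (i j : 'I_n) (S : {set 'I_n}).

(** A generator with a label other than [k] exchanges two values on the same side of the cut between
    [k - 1] and [k]. *)
Lemma parabolic_ltn S s (k : 'I_n) x : {in S, forall i, 0 < i} ->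
  s \in parabolic S -> 0 < k -> k \notin S -> (s x < k) = (x < k).
Proof.
move=> S_gt0 /gen_prodgP[m [c cS ->]] k_gt0 kS; elim: m c cS x => [|m IHm] c cS x.
  by rewrite big_ord0 perm1.
rewrite big_ord_recl permM IHm //.
have /imsetP[i iS ->] := cS ord0; have i_gt0 := S_gt0 _ iS.
have neq_ik : i != k :> nat by apply: contraNneq kS => /ord_inj <-.
by rewrite sreflE //; case: eqP => [|_]; [|case: eqP]; lia.
Qed.

(** Labels outside [S] are cuts that no inversion crosses, and along consecutive labels of [S] the
    word decreases. All such elements thus have the same inversions. *)
Lemma inversions_parabolic S s i j : {in S, forall i, 0 < i} ->
    s \in parabolic S -> {in S, forall i, s i < s (ord_pred i)} -> i < j ->
  ((i, j) \in inversions s) = [forall k : 'I_n, (i < k <= j) ==> (k \in S)].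
Proof.
move=> S_gt0 sS desc lt_ij; rewrite inversionsP //; apply/idP/forallP => [lt_s k|].
  apply/implyP => /andP[lt_ik le_kj]; apply: contraLR lt_s => kS.
  have := parabolic_ltn i S_gt0 sS (leq_ltn_trans (leq0n i) lt_ik) kS.
  have := parabolic_ltn j S_gt0 sS (leq_ltn_trans (leq0n i) lt_ik) kS; lia.
move=> all_S; apply: (@ord_chain _ [rel x y | s y < s x]) lt_ij _ => /=.
  by move=> y x z lt_yx lt_zy; apply: ltn_trans lt_yx.
by move=> k k_ij; apply/desc/(implyP (all_S k)).
Qed.

Lemma w0P S : w0 S \in parabolic S /\
  {in parabolic S, forall s, coxlen s <= coxlen (w0 S)}.
Proof. by rewrite /w0; case: arg_maxnP => //=; apply: group1. Qed.

Lemma srefl_parabolic S i : i \in S -> srefl i \in parabolic S.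
Proof. by move=> iS; apply/mem_gen/imset_f. Qed.

(** A missing descent on either side would yield a longer element of the same subgroup. *)
Lemma w0_descents S i : {in S, forall i, 0 < i} -> i \in S ->
  w0 S i < w0 S (ord_pred i) /\ ((w0 S)^-1 i < (w0 S)^-1 (ord_pred i))%g.
Proof.
move=> S_gt0 iS; have [sS max_s] := w0P S; have i_gt0 := S_gt0 _ iS.
set s := w0 S in sS max_s *; split.
  case/orP: (ord_predP s i_gt0) => //; rewrite -{1 2}[s]invgK => lt.
  have := max_s (pcomp s (srefl i)); rewrite groupM ?srefl_parabolic // => /(_ isT).
  rewrite -coxlenV -(coxlenV s) pcomp_inv srefl_inv !coxlenE.
  by rewrite card_inversions_srefl // ltnn.
case/orP: (ord_predP s^-1 i_gt0) => // lt.
have := max_s (pcomp (srefl i) s); rewrite groupM ?srefl_parabolic // => /(_ isT).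
by rewrite !coxlenE card_inversions_srefl // ltnn.
Qed.

Lemma inversions_w0 S i j : {in S, forall i, 0 < i} -> i < j ->
  ((i, j) \in inversions (w0 S)) = [forall k : 'I_n, (i < k <= j) ==> (k \in S)].
Proof.
move=> S_gt0 lt_ij; apply: inversions_parabolic => //; first by case: (w0P S).
by move=> k kS; have [] := w0_descents S_gt0 kS.
Qed.

Lemma w0V S : {in S, forall i, 0 < i} -> ((w0 S)^-1 = w0 S)%g.
Proof.
move=> S_gt0; apply/inversions_inj/setP => -[i j]; rewrite 2!inversionsE.
case: ltnP => //= lt_ij; rewrite -!inversionsP // inversions_w0 //.
apply: inversions_parabolic => //; first by rewrite groupV; case: (w0P S).
by move=> k kS; have [] := w0_descents S_gt0 kS.
Qed.

(** Left multiplication by the longest element reverses all values, so it complements the inversions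
    of w0(S^c). *)
Lemma inversions_w1 S i j : i < j ->
  ((i, j) \in inversions (w1 S)) = [exists k : 'I_n, (i < k <= j) && (k \in S)].
Proof.
move=> lt_ij; rewrite inversionsP // !pcompE.
set t := w0 (labels n :\: S).
have t_inv : (t j < t i) = [forall k : 'I_n, (i < k <= j) ==> (k \notin S)].
  rewrite -inversionsP // inversions_w0 // => [|k]; last by rewrite !inE => /andP[].
  by apply: eq_forallb => k; rewrite !inE; case: k => -[|k] ?; rewrite ?andbT //= ltn0.
have rev (x y : 'I_n) : x < y -> w0 (labels n) y < w0 (labels n) x.
  move=> lt_xy; rewrite -inversionsP // inversions_w0 // => [|k]; last by rewrite inE.
  by apply/forallP => k; apply/implyP => /andP[lt_xk _]; rewrite inE; lia.
have neq_t : t i != t j :> nat.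
  by apply: contraTneq lt_ij => /ord_inj/perm_inj ->; rewrite ltnn.
have -> : [exists k : 'I_n, (i < k <= j) && (k \in S)] = ~~ (t j < t i).
  rewrite t_inv negb_forall; apply: eq_existsb => k.
  by rewrite negb_imply negbK.
have [lt|ge] := ltnP (t j) (t i); first by have := rev _ _ lt; lia.
by apply: rev; lia.
Qed.

End LongestElements.

(** * Descent-preserving isomorphisms of left weak intervals *)

Section DescentIsomorphisms.
Variable n : nat.
Implicit Types (s t u g : 'S_n) (i j : 'I_n) (I J : {set 'S_n}).

Lemma mem_intL s t u : (u \in intL s t) = leL s u && leL u t.
Proof. by rewrite inE. Qed.

Lemma intL_bounds s t : leL s t -> s \in intL s t /\ t \in intL s t.
Proof. by move=> le_st; rewrite !mem_intL !leL_refl le_st. Qed.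

Lemma intL_inj s t s' t' : leL s t -> leL s' t' -> intL s t = intL s' t' ->
  s = s' /\ t = t'.
Proof.
move=> le_st le_st' E; have [sI tI] := intL_bounds le_st.
have [sI' tI'] := intL_bounds le_st'; move: sI tI sI' tI'; rewrite E -{3 4}E.
by rewrite !mem_intL => /andP[? _] /andP[_ ?] /andP[? _] /andP[_ ?];
  split; apply: leL_anti.
Qed.

(* Going up along s_i creates no new left descent besides i, so the labels of
   the covers can be read off the descent sets. *)
Lemma DesL_cover g i j : 0 < i -> (g^-1)%g (ord_pred i) < (g^-1)%g i ->
  j \in DesL (pcomp (srefl i) g) -> j \notin DesL g -> j = i.
Proof.
move=> i_gt0 lt_i; rewrite !in_DesL pcomp_inv srefl_inv !pcompE.
case: ltnP => //= j_gt0 lt_j; rewrite -leqNgt => le_j.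
apply/ord_inj/eqP; apply: contraTT lt_j => ne_ji; rewrite -leqNgt.
have E (x y : 'I_n) : x = y :> nat -> (g^-1)%g x = (g^-1)%g y :> nat by move/ord_inj->.
have sj := sreflE j i_gt0; have sj1 := sreflE (ord_pred j) i_gt0.
move: sj sj1; rewrite !pred_ordE //.
case: eqP => [j_i|_] sj.
  case: eqP => [|_]; first by lia.
  case: eqP => [|_ sj1]; first by lia.
  have -> : (g^-1)%g (srefl i (ord_pred j)) = (g^-1)%g (ord_pred j) :> nat.
    by apply: E; rewrite sj1 pred_ordE.
  have -> : (g^-1)%g (srefl i j) = (g^-1)%g i :> nat.
    by apply: E; rewrite sj.
  have ji : (g^-1)%g j = (g^-1)%g (ord_pred i) :> nat.
    by apply: E; rewrite pred_ordE.
  by move: le_j; rewrite ji => /leq_trans; apply; apply: ltnW.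
move: sj; rewrite (negPf ne_ji) => sj.
have -> : (g^-1)%g (srefl i j) = (g^-1)%g j :> nat by apply: E; rewrite sj.
case: eqP => [|_]; first by lia.
case: eqP => [j_i|_] sj1.
  have -> : (g^-1)%g (srefl i (ord_pred j)) = (g^-1)%g (ord_pred i) :> nat.
    by apply: E; rewrite sj1 pred_ordE.
  have ji : (g^-1)%g (ord_pred j) = (g^-1)%g i :> nat.
    by apply: E; rewrite pred_ordE.
  by apply: leq_trans le_j; rewrite ji ltnW.
have -> // : (g^-1)%g (srefl i (ord_pred j)) = (g^-1)%g (ord_pred j) :> nat.
by apply: E; rewrite sj1 pred_ordE.
Qed.

Lemma leL_last_cover s t : leL s t -> s != t -> exists i : 'I_n,
  [/\ 0 < i, leL s (pcomp (srefl i) t)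
    & ((pcomp (srefl i) t)^-1 (ord_pred i) < (pcomp (srefl i) t)^-1 i)%g].
Proof.
case/connectP=> p; case/lastP: p => [|p u] /= => [_ ->|]; first by rewrite eqxx.
rewrite rcons_path last_rcons => /andP[pth /coverLP[i [i_gt0 lt_i uE]]] -> _.
exists i; rewrite uE pcomp_sreflK; split=> //.
by apply/connectP; exists p.
Qed.

Lemma leL_first_cover s t : leL s t -> s != t -> exists i : 'I_n,
  [/\ 0 < i, leL (pcomp (srefl i) s) t & ((s^-1) (ord_pred i) < (s^-1) i)%g].
Proof.
case/connectP=> -[|u p] /= => [_ ->|]; first by rewrite eqxx.
case/andP=> /coverLP[i [i_gt0 lt_i ->]] pth tE _; exists i; split=> //.
by apply/connectP; exists p.
Qed.

Lemma leL_card s t : leL s t -> #|inversions t| <= #|inversions s| -> s = t.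
Proof.
move=> /leLP sub le; apply: inversions_inj; apply/eqP.
by rewrite eqEcard sub.
Qed.

Lemma equivD_translation s t s' t' (f : 'S_n -> 'S_n) :
    leL s t -> leL s' t' ->
    poset_iso (fun u => u \in intL s t) (@leL n)
              (fun u => u \in intL s' t') (@leL n) f ->
    (forall u, u \in intL s t -> DesL (f u) = DesL u) ->
  [/\ f s = s', f t = t'
    & forall u, u \in intL s t -> f u = pcomp u (pcomp s^-1 s')].
Proof.
move=> le_st le_st' [fI f_inj f_surj f_le] f_des.
have [sI tI] := intL_bounds le_st; have [sI' tI'] := intL_bounds le_st'.
have fs : f s = s'.
  have [x xI fx] := f_surj _ sI'; apply: leL_anti; last first.
    by have := fI _ sI; rewrite mem_intL => /andP[].
  by rewrite -fx; apply/(f_le _ _ sI xI); move: xI; rewrite mem_intL => /andP[].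
have ft : f t = t'.
  have [x xI fx] := f_surj _ tI'; apply: leL_anti.
    by have := fI _ tI; rewrite mem_intL => /andP[].
  by rewrite -fx; apply/(f_le _ _ xI tI); move: xI; rewrite mem_intL => /andP[].
split=> // u; have [m] := ubnP #|inversions u|; elim: m u => // m IHm u lt_m uI.
have [<-|ne_su] := eqVneq s u.
  by rewrite fs /pcomp -mulgA mulVg mulg1.
have /andP[le_su le_ut] : leL s u && leL u t by rewrite -mem_intL.
have [i [i_gt0 le_sv lt_i]] := leL_last_cover le_su ne_su.
set v := pcomp (srefl i) u in le_sv lt_i.
have uE : u = pcomp (srefl i) v by rewrite pcomp_sreflK.
have card_u : #|inversions u| = #|inversions v|.+1.
  by rewrite {1}uE card_inversions_srefl.
have le_vu : leL v u by rewrite uE; apply/connect1/coverLP; exists i.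
have vI : v \in intL s t by rewrite mem_intL le_sv (leL_trans le_vu).
have fv : f v = pcomp v (pcomp s^-1 s') by apply: IHm; rewrite // -ltnS -card_u.
have ne_f : f v != f u.
  apply: contraTneq lt_m => /(f_inj _ _ vI uI) E.
  by move: card_u; rewrite -E => /eqP; rewrite -[X in X == _]addn0 -addn1 eqn_add2l.
(* A first cover above [f v] on a chain to [f u] pulls back to an element strictly above [v] and
   below [u], hence to [u] itself, as [u] covers [v]. *)
have [j [j_gt0 le_wu lt_j]] := leL_first_cover ((f_le _ _ vI uI).1 le_vu) ne_f.
set w := pcomp (srefl j) (f v) in le_wu.
have le_fvw : leL (f v) w by apply/connect1/coverLP; exists j.
have wI : w \in intL s' t'.
  have := fI _ vI; have := fI _ uI; rewrite !mem_intL.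
  by case/andP=> _ h1 /andP[h2 _]; rewrite (leL_trans h2) // (leL_trans le_wu).
have [x xI fx] := f_surj _ wI.
have xu : x = u.
  apply: leL_card; first by apply/(f_le _ _ xI uI); rewrite fx.
  have le_vx : leL v x by apply/(f_le _ _ vI xI); rewrite fx.
  rewrite card_u ltnNge; apply/negP => /(leL_card le_vx) E.
  have /(congr1 (fun g => #|inversions g|)) : w = f v by rewrite -fx E.
  rewrite card_inversions_srefl // => /eqP.
  by rewrite -[X in _ == X]addn0 -addn1 eqn_add2l.
have fu : f u = pcomp (srefl j) (f v) by rewrite -xu fx.
(* The label [j] enters the descent set from [f v] to [f u], hence from [v] to [u], so it is the
   label of that cover. *)
have ji : j = i.
  apply: (DesL_cover i_gt0 lt_i).
    rewrite -uE -f_des // fu in_DesL j_gt0 pcomp_inv srefl_inv !pcompE.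
    by rewrite /srefl tpermL tpermR.
  by rewrite -f_des // in_DesL j_gt0 -leqNgt ltnW.
by rewrite fu ji fv [in RHS]uE /pcomp !mulgA.
Qed.

Lemma le_intE s t s' t' : leL s t -> leL s' t' ->
  le_int (intL s t) (intL s' t') <-> leR s s'.
Proof.
move=> le_st le_st'; split=> [|le]; last by exists s, t, s', t'.
case=> a [b [a' [b' [[le_ab E] [le_ab' E'] le]]]].
have [-> _] := intL_inj le_st le_ab E.
by have [-> _] := intL_inj le_st' le_ab' E'.
Qed.

End DescentIsomorphisms.

(** * Linear extensions of the NE and SE orders of a planar diagram *)

(* A diagram with n boxes is indexed by 'I_n in its column order (columns from
   left to right, each from bottom to top), [X i] and [Y i] being the column and
   the row of the i-th box, and [r i] its position in the row order (rows from
   bottom to top, each from left to right). A standard filling w is a permutation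
   of 'I_n; since the column order is the identity here, the linear extensions of
   the north-east order, transported by w, have minimum w^-1 and maximum
   r o w^-1. *)
Section PlanarPosets.
Variables (n : nat) (X Y : 'I_n -> nat) (r : 'S_n).
Implicit Types (i j k : 'I_n) (w u : 'S_n) (J : {set 'S_n}).

Hypothesis colE : forall i j,
  (i < j) = (X i < X j) || (X i == X j) && (Y i < Y j).
Hypothesis rowE : forall i j,
  (r i < r j) = (Y i < Y j) || (Y i == Y j) && (X i < X j).
(* In other words, the covers of the north-east order lie in a row or a column. *)
Hypothesis between : forall i j, X i < X j -> Y i < Y j -> exists k,
  [/\ k != i, k != j, X i <= X k <= X j & Y i <= Y k <= Y j].

Definition SElin w := forall i j, X i <= X j -> Y j <= Y i -> w i <= w j.

(** The word [u] is indexed by the values of [w], so [u (w i)] is the entry of the i-th box. *)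
Definition NElin w u := forall i j, X i <= X j -> Y i <= Y j -> u (w i) <= u (w j).

Definition NEint w := intL w^-1%g (pcomp r w^-1).

Lemma XY_inj i j : X i = X j -> Y i = Y j -> i = j.
Proof.
move=> EX EY; apply/ord_inj/eqP; rewrite eqn_leq (leqNgt i) (leqNgt j) !colE EX EY.
by rewrite !ltnn eqxx.
Qed.

Lemma col_leX i j : i <= j -> X i <= X j.
Proof.
rewrite leq_eqVlt => /orP[/eqP/ord_inj -> //|]; rewrite colE; lia.
Qed.

Lemma row_leY i j : r i <= r j -> Y i <= Y j.
Proof.
rewrite leq_eqVlt => /orP[/eqP/ord_inj/perm_inj -> //|]; rewrite rowE; lia.
Qed.

Lemma perm_ltn w i j : i != j -> w i <= w j -> w i < w j.
Proof.
by rewrite ltn_neqAle => ne ->; rewrite andbT val_eqE (inj_eq perm_inj).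
Qed.

(** An NE-comparable pair that [w] orders backwards is inverted by the minimum, and one that [w]
    respects is not inverted by the maximum. Conversely, SE-linearity of [w] leaves no backward SE
    relation between increasing positions, so a pair inverted by the minimum, or not inverted by the
    maximum, is NE-comparable. *)
Lemma NEintP w u : SElin w -> u \in NEint w <-> NElin w u.
Proof.
move=> w_lin; rewrite mem_intL.
split=> [/andP[/leLP sub1 /leLP sub2] i j leX leY|u_lin].
  have [->//|ne_ij] := eqVneq i j.
  have neX : X i != X j \/ Y i != Y j.
    have [EX|] := eqVneq (X i) (X j); last by left.
    by right; apply: contraNneq ne_ij => /(XY_inj EX) ->.
  have lt_ij : i < j by rewrite colE; move: neX; lia.
  have rlt_ij : r i < r j by rewrite rowE; move: neX; lia.
  have [lt_w|lt_w|/ord_inj/perm_inj E] := ltngtP (w i) (w j); last first.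
  - by rewrite E eqxx in ne_ij.
  - have /(subsetP sub1) : (w j, w i) \in inversions w^-1.
      by rewrite inversionsP // !permK.
    by rewrite inversionsP // => /ltnW.
  rewrite leqNgt; apply: contraL rlt_ij => lt_u.
  have /(subsetP sub2) : (w i, w j) \in inversions u by rewrite inversionsP.
  by rewrite inversionsP // !pcompE !permK => /ltnW; rewrite leqNgt.
have key (x y : 'I_n) : x < y ->
    ~~ ((X (w^-1 y)%g <= X (w^-1 x)%g) && (Y (w^-1 x)%g <= Y (w^-1 y)%g)).
  move=> lt_xy; apply: contraL lt_xy => /andP[le1 le2].
  by have := w_lin _ _ le1 le2; rewrite !permKV leqNgt.
apply/andP; split; apply/leLP/subsetP => -[x y]; rewrite !inversionsE;
  move=> /andP[lt_xy]; rewrite lt_xy /=; have := key _ _ lt_xy.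
  rewrite colE => nse lt.
  have := u_lin (w^-1 y)%g (w^-1 x)%g; rewrite !permKV => le_u.
  apply: perm_ltn; last by apply: le_u; move: nse lt; lia.
  by apply: contraTneq lt_xy => ->; rewrite ltnn.
move=> nse lt_u; rewrite !pcompE rowE.
have := u_lin (w^-1 x)%g (w^-1 y)%g; rewrite !permKV => le_u.
have : ~~ ((X (w^-1 x)%g <= X (w^-1 y)%g) && (Y (w^-1 x)%g <= Y (w^-1 y)%g)).
  by apply: contraL lt_u => /andP[le1 le2]; rewrite -leqNgt le_u.
by move: nse; lia.
Qed.

Lemma NEint_SigmaL w (P : rel 'I_n) : SElin w ->
    (forall i j, P (w i) (w j) = (X i <= X j) && (Y i <= Y j)) ->
  NEint w = SigmaL P.
Proof.
move=> w_lin PE; apply/setP => u; rewrite [in RHS]inE; apply/idP/idP.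
  move/(NEintP _ w_lin) => u_lin; apply/forallP => x; apply/forallP => y.
  apply/implyP; rewrite -{1}[x](permKV w) -{1}[y](permKV w) PE => /andP[le1 le2].
  by have := u_lin _ _ le1 le2; rewrite !permKV.
move/forallP=> uP; apply/(NEintP _ w_lin) => i j le1 le2.
by move/forallP: (uP (w i)) => /(_ (w j)); rewrite PE le1 le2.
Qed.

Lemma NEint_bounds w : SElin w -> leL w^-1%g (pcomp r w^-1).
Proof.
move=> w_lin; have : (w^-1)%g \in NEint w; last by rewrite mem_intL => /andP[].
apply/(NEintP _ w_lin) => i j le1 le2; rewrite !permK leqNgt colE.
by move: le1 le2; lia.
Qed.

(** Two SE-linear fillings agree on SE-comparable boxes, and boxes that are not SE-comparable are
    strictly NE-comparable. *)
Lemma SE_NE_cases w w' i j : SElin w -> SElin w' -> w i < w j -> w' j < w' i ->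
  (X i < X j) && (Y i < Y j) || (X j < X i) && (Y j < Y i).
Proof.
move=> w_lin w_lin' lt lt'.
have : ~~ ((X j <= X i) && (Y i <= Y j)).
  by apply: contraL lt => /andP[le1 le2]; rewrite -leqNgt w_lin.
have : ~~ ((X i <= X j) && (Y j <= Y i)).
  by apply: contraL lt' => /andP[le1 le2]; rewrite -leqNgt w_lin'.
by lia.
Qed.

(** The right translation carrying [w^-1] to [w'^-1]: each box keeps its entry while its position
    changes from [w i] to [w' i]. *)
Definition relabel w w' u : 'S_n := pcomp u (pcomp w w'^-1).

Lemma relabelE w w' u i : relabel w w' u (w' i) = u (w i).
Proof. by rewrite !pcompE permK. Qed.

Lemma relabelK w w' : cancel (relabel w w') (relabel w' w).
Proof. by move=> u; apply/permP => i; rewrite !pcompE !permK !permKV. Qed.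

Lemma relabel_NElin w w' u : NElin w u -> NElin w' (relabel w w' u).
Proof. by move=> u_lin i j leX leY; rewrite !relabelE u_lin. Qed.

(** If [w] and [w'] order two boxes alike, an inversion is transported; otherwise the boxes are
    strictly NE-comparable and [u] and [v] order them alike. *)
Lemma relabel_leL w w' u v : SElin w -> SElin w' -> NElin w v ->
  NElin w u -> leL u v -> leL (relabel w w' u) (relabel w w' v).
Proof.
move=> w_lin w_lin' v_lin u_lin /leLP/subsetP sub; apply/leLP/subsetP => -[x y].
rewrite !inversionsE => /andP[lt_xy]; rewrite lt_xy /=; move: lt_xy.
rewrite -[x](permKV w') -[y](permKV w') !relabelE.
move: (w'^-1 x)%g (w'^-1 y)%g => i j lt' lt_u.
have [lt|lt|/ord_inj/perm_inj E] := ltngtP (w i) (w j); last first.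
- by move: lt'; rewrite E ltnn.
- have ne : w j != w i by apply: contraTneq lt => ->; rewrite ltnn.
  apply: (perm_ltn ne).
  have /orP[/andP[lt1 lt2]|/andP[lt1 lt2]] := SE_NE_cases w_lin w_lin' lt lt'.
    by apply: v_lin; apply: ltnW.
  by have := u_lin _ _ (ltnW lt1) (ltnW lt2); rewrite leqNgt lt_u.
have /sub : (w i, w j) \in inversions u by rewrite inversionsP.
by rewrite inversionsP.
Qed.

(** Were [m] a descent after translation only, the boxes with the consecutive entries at label [m]
    would be ordered differently by [w] and [w'], hence strictly NE-comparable. A box given by
    [between] would then need an entry strictly between them. *)
Lemma relabel_DesL_sub w w' u : SElin w -> SElin w' -> NElin w u ->
  DesL (relabel w w' u) \subset DesL u.
Proof.
move=> w_lin w_lin' u_lin; apply/subsetP => m; rewrite !in_DesL => /andP[m_gt0].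
rewrite m_gt0 /= !pcomp_inv invgK !pcompE.
have := permKV u m; have := permKV u (ord_pred m).
move: (u^-1 m)%g (u^-1 (ord_pred m))%g => y x ux uy.
rewrite -[in X in _ -> X](permKV w x) -[in X in _ -> X](permKV w y).
move: ux uy; rewrite -{1}(permKV w x) -{1}(permKV w y).
move: (w^-1 x)%g (w^-1 y)%g => i j {x y} ui uj lt'.
have [//|lt|/ord_inj/perm_inj E] := ltngtP (w j) (w i); last first.
  by move: lt'; rewrite E ltnn.
have mE : (u (w i)).+1 = u (w j) by rewrite ui uj pred_ordE // prednK.
have /orP[/andP[lt1 lt2]|/andP[lt1 lt2]] := SE_NE_cases w_lin w_lin' lt lt'.
  have [k [ki kj /andP[le1 le2] /andP[le3 le4]]] := between lt1 lt2.
  have neu (a b : 'I_n) : a != b -> u (w a) != u (w b) :> nat.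
    by apply: contraNneq => /ord_inj/perm_inj/perm_inj ->.
  have := u_lin _ _ le1 le3; have := u_lin _ _ le2 le4.
  by have := neu _ _ ki; have := neu _ _ kj; move: mE; lia.
by have := u_lin _ _ (ltnW lt1) (ltnW lt2); move: mE; lia.
Qed.

Lemma NEint_equivD w w' : SElin w -> SElin w' -> equivD (NEint w) (NEint w').
Proof.
move=> w_lin w_lin'; exists (relabel w w').
  split=> [u|u v _ _|u|u v].
  - by move/(NEintP _ w_lin)/(relabel_NElin w')/(NEintP _ w_lin').
  - exact: (can_inj (relabelK w w')).
  - move/(NEintP _ w_lin')/(relabel_NElin w)/(NEintP _ w_lin) => uI.
    by exists (relabel w' w u); rewrite ?relabelK.
  move=> /(NEintP _ w_lin) u_lin /(NEintP _ w_lin) v_lin.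
  split; first exact: relabel_leL.
  move/(relabel_leL w_lin' w_lin); rewrite !relabelK; apply; exact: relabel_NElin.
move=> u /(NEintP _ w_lin) u_lin; apply/eqP; rewrite eqEsubset.
rewrite relabel_DesL_sub //= -{1}(relabelK w w' u) relabel_DesL_sub //.
exact: relabel_NElin.
Qed.

Lemma equivD_NEint w J : SElin w -> is_intL J -> equivD (NEint w) J ->
  exists2 w', SElin w' & J = NEint w'.
Proof.
move=> w_lin [s [t [le_st ->]]] [f f_iso f_des].
have le_w := NEint_bounds w_lin.
have [fs ft fE] := equivD_translation le_w le_st f_iso f_des.
have [sI tI] := intL_bounds le_w; set w' := (s^-1)%g.
have tE : t = pcomp r w'^-1.
  rewrite -ft fE // /w' invgK; apply/permP => i.
  by rewrite !pcompE invgK !permK.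
exists w'; last by rewrite /NEint -tE /w' invgK.
have Des_s : DesL s = DesL w^-1 by rewrite -fs f_des.
have Des_t : DesL t = DesL (pcomp r w^-1) by rewrite -ft f_des.
move=> i j leX leY; have [->//|ne_ij] := eqVneq i j.
(* Same column: the indices from [j] to [i] stay in this column, and their labels are descents of
   the minimum. *)
have [EX|neX] := eqVneq (X i) (X j).
  have ltY : Y j < Y i.
    by rewrite ltn_neqAle leY andbT; apply: contraNneq ne_ij => /esym/(XY_inj EX) ->.
  have lt_ji : j < i by rewrite colE EX eqxx ltY orbT.
  apply: ltnW; apply: (@ord_chain _ [rel x y | w' y < w' x]) lt_ji _ => /=.
    by move=> y x z /= ? ?; lia.
  move=> k /andP[lt_jk le_ki]; have k_gt0 : 0 < k by lia.
  have lt_k : ord_pred k < k by rewrite pred_ordE //; lia.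
  have EXk : X (ord_pred k) = X k.
    have /col_leX : j <= ord_pred k by rewrite pred_ordE //; lia.
    by have := col_leX (ltnW lt_k); have := col_leX le_ki; lia.
  have ltYk : Y (ord_pred k) < Y k by move: lt_k; rewrite colE EXk; lia.
  have : k \in DesL s.
    rewrite Des_s in_DesL k_gt0 invgK /=; apply: perm_ltn.
      by apply: contraTneq lt_k => <-; rewrite ltnn.
    by apply: w_lin; rewrite ?EXk // ltnW.
  by rewrite in_DesL => /andP[].
have ltX : X i < X j by rewrite ltn_neqAle neX.
(* Same row: the ranks from [r i] to [r j] stay in this row, and their labels are not descents of
   the maximum. *)
have [EY|neY] := eqVneq (Y i) (Y j).
  have rlt_ij : r i < r j by rewrite rowE EY eqxx ltX orbT.
  have := @ord_chain _ [rel x y | w' (r^-1 x)%g < w' (r^-1 y)%g] _ _ _ rlt_ij.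
  rewrite /= !permK => h; apply/ltnW/h => {h} [y x z /=|k]; first exact: ltn_trans.
  case/andP=> lt_ik le_kj; have k_gt0 : 0 < k by lia.
  have lt_k : ord_pred k < k by rewrite pred_ordE //; lia.
  have : k \notin DesL t; last first.
    rewrite in_DesL k_gt0 tE pcomp_inv invgK !pcompE -leqNgt => le_k.
    apply: perm_ltn => //; apply: contraTneq lt_k => /perm_inj ->.
    by rewrite ltnn.
  rewrite Des_t in_DesL k_gt0 pcomp_inv invgK !pcompE -leqNgt /=.
  have le_k : r i <= ord_pred k by rewrite pred_ordE //; lia.
  move: lt_k le_kj le_k; move: (permKV r k) (permKV r (ord_pred k)).
  move: (r^-1 k)%g (r^-1 (ord_pred k))%g => a b <- <- lt_ba le_aj le_ib.
  have := row_leY (ltnW lt_ba); have := row_leY le_aj; have := row_leY le_ib.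
  by move: lt_ba; rewrite rowE => *; apply: w_lin; lia.
have ltY : Y j < Y i by rewrite ltn_neqAle eq_sym neY.
have lt_ij : i < j by rewrite colE ltX.
(* Strictly SE boxes: ordered backwards by [w'], they would be inverted by the lower end of the
   interval and not by the upper one. *)
rewrite leqNgt; apply/negP => lt_w.
have : (w' j, w' i) \in inversions s by rewrite inversionsP // -[s]invgK !permK.
move/leLP/subsetP: le_st => le_st /le_st; rewrite inversionsP // tE !pcompE !permK.
by rewrite rowE; lia.
Qed.

Lemma classD_NEint w J : SElin w ->
  classD (NEint w) J <-> exists2 w', SElin w' & J = NEint w'.
Proof.
move=> w_lin; split=> [[J_int wJ]|[w' w_lin' ->]]; first exact: equivD_NEint wJ.
split; last exact: NEint_equivD.
by exists (w'^-1)%g, (pcomp r w'^-1); split=> //; apply: NEint_bounds.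
Qed.

Lemma le_int_NEint w w' : SElin w -> SElin w' ->
  le_int (NEint w) (NEint w') <-> leL w w'.
Proof.
move=> w_lin w_lin'; rewrite le_intE; try exact: NEint_bounds.
by rewrite leRV !invgK.
Qed.

(** Such a [wmin] inverts only pairs in one column, and every SE-linear filling inverts those. *)
Lemma leL_SEmin (wmin w : 'S_n) : SElin w ->
    (forall i j, (wmin i < wmin j) = (X i < X j) || (X i == X j) && (Y j < Y i)) ->
  leL wmin w.
Proof.
move=> w_lin wminE; apply/leLP/subsetP => -[i j]; rewrite !inversionsE.
move=> /andP[lt_ij]; rewrite lt_ij /= wminE; move: (lt_ij); rewrite colE => h1 h2.
apply: perm_ltn; first by apply: contraTneq lt_ij => ->; rewrite ltnn.
by apply: w_lin; lia.
Qed.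

(** A pair inverted by an SE-linear filling is not SE-ordered, so its second box lies strictly
    higher and [wmax] puts it first. *)
Lemma leL_SEmax (wmax w : 'S_n) : SElin w ->
    (forall i j, (wmax i < wmax j) = (Y j < Y i) || (Y i == Y j) && (X i < X j)) ->
  leL w wmax.
Proof.
move=> w_lin wmaxE; apply/leLP/subsetP => -[i j]; rewrite !inversionsE.
move=> /andP[lt_ij]; rewrite lt_ij /= wmaxE => lt_w.
have : ~~ ((X i <= X j) && (Y j <= Y i)).
  by apply: contraL lt_w => /andP[le1 le2]; rewrite -leqNgt w_lin.
by move: lt_ij; rewrite colE; lia.
Qed.

End PlanarPosets.

(** * Permutations and their words *)

Section Words.
Variable n : nat.
Implicit Types (s t : 'S_n) (w : seq nat).

Lemma size_word s : size (word s) = n.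
Proof. by rewrite size_map size_enum_ord. Qed.

Lemma nth_word s (i : 'I_n) : nth 0 (word s) i = (s i).+1.
Proof. by rewrite (nth_map i) ?size_enum_ord // nth_ord_enum. Qed.

Lemma word_perm s : perm_eq (word s) (iota 1 n).
Proof.
have word_uniq : uniq (word s).
  rewrite map_inj_uniq ?enum_uniq // => i j /succn_inj/ord_inj.
  exact: perm_inj.
apply: uniq_perm => //; first exact: iota_uniq.
have sub : {subset word s <= iota 1 n}.
  by move=> k /mapP[i _ ->]; rewrite mem_iota add1n /= ltnS; apply: ltn_ord.
by case: (uniq_min_size word_uniq sub) => //; rewrite size_word size_iota.
Qed.

(** Such a word comes from a permutation, so the default value of [perm_of_word] is not taken. *)
Lemma perm_of_wordK w : perm_eq w (iota 1 n) -> word (perm_of_word n w) = w.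
Proof.
move=> w_perm; rewrite /perm_of_word; case: pickP => [s /eqP //|no_s].
have w_size : size w = n by rewrite (perm_size w_perm) size_iota.
have w_mem (i : 'I_n) : 0 < nth 0 w i <= n.
  have : nth 0 w i \in iota 1 n by rewrite -(perm_mem w_perm) mem_nth ?w_size.
  by rewrite mem_iota; lia.
have w_ltn (i : 'I_n) : (nth 0 w i).-1 < n by have := w_mem i; lia.
have inj_s : injective (fun i => Ordinal (w_ltn i)).
  move=> i j /(congr1 (@nat_of_ord n)) /= E; apply: ord_inj; apply/eqP.
  rewrite -(nth_uniq 0 (_ : i < size w) (_ : j < size w)) ?w_size //.
    have := w_mem i; have := w_mem j; move: E.
    by case: (nth 0 w i) => // ?; case: (nth 0 w j) => //= ? ->.
  by rewrite (perm_uniq w_perm) iota_uniq.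
case/eqP: (no_s (perm inj_s)); apply: (@eq_from_nth _ 0); rewrite size_word //.
move=> i lt_i; rewrite -[i]/(nat_of_ord (Ordinal lt_i)) nth_word permE /=.
by have := w_mem (Ordinal lt_i); rewrite /=; lia.
Qed.

Lemma perm_of_wordE w (i : 'I_n) : perm_eq w (iota 1 n) ->
  (perm_of_word n w i).+1 = nth 0 w i.
Proof. by move=> w_perm; rewrite -nth_word perm_of_wordK. Qed.

End Words.

(** * Labelings of a finite sequence and the permutations relating them *)

Section Labelings.
Variables (T : eqType) (x0 : T) (s0 : seq T) (n : nat).
Implicit Types (F G H : T -> nat).

Definition labeling F := perm_eq [seq F b | b <- s0] (iota 1 n).

Definition at_label F k := nth x0 s0 (index k [seq F b | b <- s0]).

(** This is [G] composed with the inverse of [F], presented as the word of [G] read in the order of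
    [F], which is the form of the reading words. *)
Definition relabeling F G : 'S_n :=
  perm_of_word n [seq G (at_label F k) | k <- iota 1 n].

Lemma labeling_inj F : labeling F -> {in s0 &, injective F}.
Proof.
move=> F_lab x y xs ys E; apply: (index_inj x xs ys); apply/eqP.
rewrite -(@nth_uniq _ 0 [seq F b | b <- s0]) ?size_map ?index_mem //.
  by rewrite !(nth_map x) ?index_mem // !nth_index // E.
by rewrite (perm_uniq F_lab) iota_uniq.
Qed.

Lemma labeling_bounds F b : labeling F -> b \in s0 -> 0 < F b <= n.
Proof.
move=> F_lab bs; have : F b \in iota 1 n by rewrite -(perm_mem F_lab) map_f.
by rewrite mem_iota; lia.
Qed.

Lemma at_labelP F k : labeling F -> 0 < k <= n ->
  at_label F k \in s0 /\ F (at_label F k) = k.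
Proof.
move=> F_lab k_n; have k_in : k \in [seq F b | b <- s0].
  by rewrite (perm_mem F_lab) mem_iota; lia.
have lt_k : index k [seq F b | b <- s0] < size s0 by rewrite -(size_map F) index_mem.
split; first by rewrite mem_nth.
by rewrite /at_label -(nth_map x0 0) // nth_index.
Qed.

Lemma at_labelK F b : labeling F -> b \in s0 -> at_label F (F b) = b.
Proof.
move=> F_lab bs; have [? ?] := at_labelP F_lab (labeling_bounds F_lab bs).
exact: labeling_inj F_lab _ _ _ _ _.
Qed.

Lemma relabeling_perm F G : labeling F -> labeling G ->
  perm_eq [seq G (at_label F k) | k <- iota 1 n] (iota 1 n).
Proof.
move=> F_lab G_lab; apply: perm_trans G_lab.
have -> : [seq G b | b <- s0] = [seq G (at_label F k) | k <- [seq F b | b <- s0]].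
  by rewrite -map_comp; apply/eq_in_map => b bs /=; rewrite at_labelK.
by apply: perm_map; rewrite perm_sym.
Qed.

Lemma relabelingE F G (i : 'I_n) : labeling F -> labeling G ->
  (relabeling F G i).+1 = G (at_label F i.+1).
Proof.
move=> F_lab G_lab; rewrite perm_of_wordE ?relabeling_perm //.
by rewrite (nth_map 0) ?size_iota // nth_iota.
Qed.

Lemma relabeling_ltn F G (i j : 'I_n) : labeling F -> labeling G ->
  (relabeling F G i < relabeling F G j) =
  (G (at_label F i.+1) < G (at_label F j.+1)).
Proof. by move=> F_lab G_lab; rewrite -ltnS !relabelingE. Qed.

Lemma relabeling_comp F G H : labeling F -> labeling G -> labeling H ->
  pcomp (relabeling G H) (relabeling F G) = relabeling F H.
Proof.
move=> F_lab G_lab H_lab; apply/permP => i; apply: ord_inj; apply: succn_inj.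
have [bs _] := @at_labelP F i.+1 F_lab (ltn_ord i).
by rewrite pcompE !relabelingE // at_labelK.
Qed.

Lemma relabelingV F G : labeling F -> labeling G ->
  ((relabeling F G)^-1 = relabeling G F)%g.
Proof.
move=> F_lab G_lab; apply/eqP; rewrite eq_invg_mul.
rewrite -[(_ * _)%g]/(pcomp _ _) relabeling_comp //.
apply/eqP/permP => i; rewrite perm1; apply: ord_inj; apply: succn_inj.
by rewrite relabelingE //; case: (@at_labelP F i.+1 F_lab (ltn_ord i)).
Qed.

Lemma perm_of_word_relabeling F G (A : seq T) : labeling F ->
    {subset A <= s0} -> [seq F b | b <- A] = iota 1 n ->
  perm_of_word n [seq G b | b <- A] = relabeling F G.
Proof.
move=> F_lab sub E; rewrite /relabeling -E -map_comp; congr (perm_of_word n _).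
by apply/eq_in_map => b bA /=; rewrite at_labelK // sub.
Qed.

End Labelings.

(** * Reading orders and reflection of boxes *)

Lemma orderTL_trans : transitive orderTL.
Proof. by move=> [x y] [x' y'] [x'' y'']; rewrite /orderTL /=; lia. Qed.

Lemma orderTL_total : total orderTL.
Proof. by move=> [x y] [x' y']; rewrite /orderTL /=; lia. Qed.

Lemma orderTL_anti : antisymmetric orderTL.
Proof.
by move=> [x y] [x' y']; rewrite /orderTL /= => h; congr (_, _); lia.
Qed.

Lemma orderLT_trans : transitive orderLT.
Proof. by move=> [x y] [x' y'] [x'' y'']; rewrite /orderLT /=; lia. Qed.

Lemma orderLT_total : total orderLT.
Proof. by move=> [x y] [x' y']; rewrite /orderLT /=; lia. Qed.

Lemma orderLT_anti : antisymmetric orderLT.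
Proof.
by move=> [x y] [x' y']; rewrite /orderLT /= => h; congr (_, _); lia.
Qed.

Lemma height_leq (D : diagram) b : b \in D -> b.2 <= height D.
Proof. by move=> bD; rewrite /height (bigD1_seq b) //= ?leq_maxl ?fset_uniq. Qed.

Lemma flip_boxK h b : b.2 <= h -> flip_box h (flip_box h b) = b.
Proof. by case: b => x y /= le_y; congr (_, _); rewrite /=; lia. Qed.

(** * Standard fillings of a diagram as permutations *)

Section Fillings.
Variables (n : nat) (D : diagram) (bx : 'I_n -> box).
Implicit Types (T U : filling) (w : 'S_n) (i j : 'I_n).

Hypothesis bx_inj : injective bx.
Hypothesis bxD : D =i [seq bx i | i <- enum 'I_n].
Hypothesis bx_sorted : forall i j, i <= j -> orderTL (bx i) (bx j).

Local Notation X := (fun i => (bx i).1).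
(** Rows are counted in the reflection of [D], so that the SE order of these coordinates is the
    order defining [ST D], while their NE order is that of the posets of reflected fillings. *)
Local Notation Y := (fun i => (flip_box (height D) (bx i)).2).

Definition reading T : 'S_n := perm_of_word n (wTL T).

Lemma bx_mem i : bx i \in D.
Proof. by rewrite bxD map_f ?mem_enum. Qed.

Lemma bx_perm : perm_eq D [seq bx i | i <- enum 'I_n].
Proof.
apply: uniq_perm => //.
by rewrite (map_inj_uniq bx_inj) enum_uniq.
Qed.

Lemma bx_leY i j : (Y i <= Y j) = ((bx j).2 <= (bx i).2).
Proof.
have /= := height_leq (bx_mem i); have /= := height_leq (bx_mem j).
rewrite /flip_box /=; lia.
Qed.

Lemma bx_sort : sort orderTL D = [seq bx i | i <- enum 'I_n].
Proof.
apply: (sorted_eq orderTL_trans orderTL_anti (sort_sorted orderTL_total _)).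
  rewrite sorted_map; apply: (@sub_sorted _ (relpre val leq)) => [i j /bx_sorted //|].
  by rewrite -sorted_map val_enum_ord iota_sorted.
by rewrite perm_sort bx_perm.
Qed.

Lemma card_D : #|` D| = n.
Proof. by rewrite (perm_size bx_perm) size_map size_enum_ord. Qed.

Lemma readingE T i : std_filling D T -> (reading T i).+1 = T (bx i).
Proof.
case=> suppT T_perm; have wTLE : wTL T = [seq T (bx i) | i <- enum 'I_n].
  by rewrite /wTL suppT bx_sort -map_comp.
rewrite perm_of_wordE; last first.
  rewrite wTLE map_comp; apply: perm_trans (perm_map _ _) _.
    by rewrite perm_sym; apply: bx_perm.
  by rewrite -card_D.
by rewrite wTLE (nth_map i) ?size_enum_ord // nth_ord_enum.
Qed.

Lemma reading_inj T U : std_filling D T -> std_filling D U ->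
  reading T = reading U -> T = U.
Proof.
move=> T_std U_std E; apply/fsfunP => b.
have [bD|nbD] := boolP (b \in D).
  have := bD; rewrite bxD => /mapP[i _ ->].
  by rewrite -!readingE // E.
by rewrite !fsfun_dflt // ?T_std.1 ?U_std.1.
Qed.

Lemma ST_SElin T : ST D T -> SElin X Y (reading T).
Proof.
case=> T_std T_le i j leX; rewrite bx_leY => leY.
by rewrite -ltnS !readingE // T_le // bx_mem.
Qed.

(** The inverse of [reading]; on [D] the [pick] succeeds because [bx] enumerates the boxes. *)
Definition fill w : filling :=
  [fsfun b in D => odflt 0 (omap (fun i => (w i).+1) [pick i | bx i == b])].

Lemma fillE w i : fill w (bx i) = (w i).+1.
Proof.
rewrite /fill fsfun_fun bx_mem; case: pickP => [j /eqP/bx_inj -> //|/(_ i)].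
by rewrite eqxx.
Qed.

Lemma fill_std w : std_filling D (fill w).
Proof.
split.
  apply/fsetP => b; apply/idP/idP; first by move/(fsubsetP (finsupp_sub _ _ _)).
  by rewrite bxD => /mapP[i _ ->]; rewrite mem_finsupp fillE.
apply: perm_trans (perm_map _ bx_perm) _; rewrite card_D -map_comp.
have -> : map (fill w \o bx) (enum 'I_n) = word w.
  by apply: eq_map => i /=; rewrite fillE.
exact: word_perm.
Qed.

Lemma reading_fill w : reading (fill w) = w.
Proof.
apply/permP => i; apply: ord_inj; apply: succn_inj.
by rewrite readingE ?fillE //; apply: fill_std.
Qed.

Lemma fill_ST w : SElin X Y w -> ST D (fill w).
Proof.
move=> w_lin; split; first exact: fill_std.
move=> b c; rewrite !bxD => /mapP[i _ ->] /mapP[j _ ->] leX leY.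
by rewrite !fillE ltnS w_lin // bx_leY.
Qed.

Lemma fill_reading T : std_filling D T -> fill (reading T) = T.
Proof.
by move=> T_std; apply: reading_inj (fill_std _) T_std _; rewrite reading_fill.
Qed.

Lemma flip_fillingE T i : std_filling D T ->
  flip_filling T (flip_box (height D) (bx i)) = T (bx i).
Proof.
move=> [suppT _]; rewrite /flip_filling suppT fsfun_fun in_imfset ?bx_mem //=.
by rewrite flip_boxK // height_leq ?bx_mem.
Qed.

(** The entries of the reflected filling are distinct, so the search by value in [box_of] finds the
    reflected box. *)
Lemma box_of_flip T i : std_filling D T ->
  box_of (flip_filling T) (reading T i).+1 = flip_box (height D) (bx i).
Proof.
move=> T_std; set F := flip_filling T; set g := fun i => flip_box (height D) (bx i).
have Fg j : F (g j) = (reading T j).+1 by rewrite readingE // -flip_fillingE.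
have F_supp b : b \in finsupp F -> exists j, b = g j.
  move=> bF; have : b \in flip_diagram D.
    by rewrite -(proj1 T_std); apply: (fsubsetP (finsupp_sub _ _ _)) bF.
  by case/imfsetP=> c /=; rewrite bxD => /mapP[j _ ->] ->; exists j.
have gF : g i \in finsupp F by rewrite mem_finsupp Fg.
rewrite -/(g i) -Fg /box_of.
have lt_i : index (F (g i)) [seq F b | b <- finsupp F] < size (finsupp F).
  by rewrite -(size_map F) index_mem map_f.
set b := nth _ _ _; have : b \in finsupp F by rewrite mem_nth.
case/F_supp => j bE; have : F b = F (g i).
  by rewrite -(nth_map _ 0) // nth_index // map_f.
by rewrite bE !Fg => -[/ord_inj/perm_inj ->].
Qed.

Lemma poset_of_flip T i j : std_filling D T ->
  poset_of (flip_filling T) (reading T i) (reading T j) =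
  (X i <= X j) && (Y i <= Y j).
Proof. by move=> T_std; rewrite /poset_of !box_of_flip. Qed.

End Fillings.

(** * The equivalence class attached to a diagram *)

Section DiagramClass.
Variables (n : nat) (D : diagram) (bx : 'I_n -> box) (r wmin wmax : 'S_n).
Implicit Types (i j k : 'I_n) (w : 'S_n).

Hypothesis bx_inj : injective bx.
Hypothesis bxD : D =i [seq bx i | i <- enum 'I_n].
Hypothesis bx_sorted : forall i j, i <= j -> orderTL (bx i) (bx j).

Local Notation X := (fun i => (bx i).1).
Local Notation Y := (fun i => (flip_box (height D) (bx i)).2).

Hypothesis rowE : forall i j,
  (r i < r j) = (Y i < Y j) || (Y i == Y j) && (X i < X j).
Hypothesis between : forall i j, X i < X j -> Y i < Y j -> exists k,
  [/\ k != i, k != j, X i <= X k <= X j & Y i <= Y k <= Y j].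
Hypothesis wminE : forall i j,
  (wmin i < wmin j) = (X i < X j) || (X i == X j) && (Y j < Y i).
Hypothesis wmaxE : forall i j,
  (wmax i < wmax j) = (Y j < Y i) || (Y i == Y j) && (X i < X j).

Lemma bx_colE i j : (i < j) = (X i < X j) || (X i == X j) && (Y i < Y j).
Proof.
have leY := bx_leY bxD; cbv beta in leY |- *; apply/idP/idP => [lt_ij|].
  have := bx_sorted (ltnW lt_ij); rewrite /orderTL.
  case/orP=> [-> //|/andP[/eqP EX le]]; rewrite EX ltnn eqxx orFb andTb ltnNge leY.
  apply: contraTN lt_ij => ge; rewrite -leqNgt.
  suff -> : i = j by [].
  apply: bx_inj; move: EX (conj le ge); rewrite [bx i]surjective_pairing.
  by rewrite [bx j]surjective_pairing /= => -> [h1 h2]; congr (_, _); lia.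
rewrite [in i < j]ltnNge; apply: contraL => /bx_sorted.
by rewrite /orderTL (ltnNge (flip_box _ _).2) leY; move: (bx i) (bx j) => b c; lia.
Qed.

Lemma wmin_lin : SElin X Y wmin.
Proof. by move=> i j leX leY; rewrite leqNgt wminE; move: leX leY => /=; lia. Qed.

Lemma wmax_lin : SElin X Y wmax.
Proof. by move=> i j leX leY; rewrite leqNgt wmaxE; move: leX leY => /=; lia. Qed.

Lemma NEint_reading T : ST D T ->
  NEint r (reading n T) = SigmaL (@poset_of n (flip_filling T)).
Proof.
move=> T_st; have w_lin := ST_SElin bx_inj bxD bx_sorted T_st.
apply: (NEint_SigmaL bx_colE rowE w_lin) => i j.
exact: (poset_of_flip bx_inj bxD bx_sorted _ _ T_st.1).
Qed.

(** The inequality in the [pick] restricts to nonempty intervals, whose ends, and hence [w], are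
    determined by the set. *)
Definition class_filling (I : {set 'S_n}) : filling :=
  fill D bx (odflt 1%g
    [pick w : 'S_n | leL w^-1%g (pcomp r w^-1) && (I == NEint r w)]).

Lemma class_fillingE w : SElin X Y w -> class_filling (NEint r w) = fill D bx w.
Proof.
move=> w_lin; rewrite /class_filling; have le_w := NEint_bounds bx_colE rowE w_lin.
case: pickP => [w' /andP[le_w' /eqP E]|/(_ w)]; last by rewrite le_w eqxx.
by have [/invg_inj ->] := intL_inj le_w le_w' E.
Qed.

(** The class consists of the [NEint r w] for SE-linear [w], and [fill] and [reading] identify these
    [w] with [ST D]; each clause becomes a statement about [leL] on SE-linear fillings. *)
Lemma diagram_class :
  ((forall I : {set 'S_n}, classD (NEint r wmax) I <->
      exists2 T : filling, ST D T & I = SigmaL (@poset_of n (flip_filling T))) /\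
   is_min (@le_int n) (classD (NEint r wmax)) (NEint r wmin) /\
   is_max (@le_int n) (classD (NEint r wmax)) (NEint r wmax)) /\
  (exists f : {set 'S_n} -> filling,
     poset_iso (classD (NEint r wmax)) (@le_int n) (ST D) (le_ST n) f).
Proof.
have classP := classD_NEint bx_colE rowE between _ wmax_lin.
have lin_ST := fill_ST bx_inj bxD; have ST_lin := ST_SElin bx_inj bxD bx_sorted.
have le_intP := le_int_NEint bx_colE rowE.
split; [split; [|split; split]|].
- move=> I; rewrite classP; split=> [[w w_lin ->]|[T T_st ->]].
    exists (fill D bx w); first exact: lin_ST.
    by rewrite -NEint_reading ?reading_fill //; apply: lin_ST.
  by exists (reading n T); [apply: ST_lin|rewrite NEint_reading].
- by apply/classP; exists wmin => //; apply: wmin_lin.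
- move=> I /classP[w w_lin ->]; apply/le_intP => //; first exact: wmin_lin.
  exact: (leL_SEmin bx_colE w_lin wminE).
- by apply/classP; exists wmax => //; apply: wmax_lin.
- move=> I /classP[w w_lin ->]; apply/le_intP => //; first exact: wmax_lin.
  exact: (leL_SEmax bx_colE w_lin wmaxE).
exists class_filling; split=> [I|I J|T T_st|I J].
- by case/classP=> w w_lin ->; rewrite class_fillingE //; apply: lin_ST.
- case/classP=> w w_lin -> /classP[w' w_lin' ->]; rewrite !class_fillingE //.
  move=> /(congr1 (reading n)); rewrite !(reading_fill bx_inj bxD bx_sorted).
  by move->.
- exists (NEint r (reading n T)).
    by apply/classP; exists (reading n T) => //; apply: ST_lin.
  by rewrite class_fillingE ?(fill_reading bx_inj bxD bx_sorted T_st.1) //; apply: ST_lin.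
case/classP=> w w_lin -> /classP[w' w_lin' ->]; rewrite !class_fillingE //.
rewrite /le_ST -!/(reading n _) !(reading_fill bx_inj bxD bx_sorted).
exact: le_intP.
Qed.

End DiagramClass.

(** * Labelings from listings, sorted indices and partial sums *)

Lemma labeling_of_listing (T : eqType) (s0 A : seq T) n (F : T -> nat) :
  perm_eq A s0 -> [seq F b | b <- A] = iota 1 n -> labeling s0 n F.
Proof. by move=> A_perm E; rewrite /labeling -E perm_sym perm_map. Qed.

Lemma labeling_of_inj (T : eqType) (s0 : seq T) n (F : T -> nat) :
    uniq s0 -> size s0 = n -> {in s0 &, injective F} ->
    {in s0, forall b, 0 < F b <= n} ->
  labeling s0 n F.
Proof.
move=> s0_uniq s0_size F_inj F_le.
have F_uniq : uniq [seq F b | b <- s0] by rewrite map_inj_in_uniq.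
apply: uniq_perm => //; first exact: iota_uniq.
have sub : {subset [seq F b | b <- s0] <= iota 1 n}.
  by move=> k /mapP[b bs ->]; rewrite mem_iota; have := F_le _ bs; lia.
by case: (uniq_min_size F_uniq sub) => //; rewrite size_map s0_size size_iota.
Qed.

Lemma index_ltn_sorted (T : eqType) (leT : rel T) (s : seq T) b c :
    transitive leT -> total leT -> antisymmetric leT ->
    sorted leT s -> b \in s -> c \in s ->
  (index b s < index c s) = ~~ leT c b.
Proof.
move=> leT_tr leT_tot leT_anti s_sorted bs cs; apply/idP/idP => [lt|].
  apply/negP => le_cb.
  have le_bc := sorted_ltn_index leT_tr s_sorted _ _ bs cs lt.
  by move: lt; rewrite (leT_anti b c) ?ltnn // le_bc.
apply: contraR; rewrite -leqNgt => le.
apply: (sorted_leq_index leT_tr _ s_sorted _ _ cs bs le).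
by move=> x; have := leT_tot x x; rewrite orbb.
Qed.

Lemma map_index_uniq (T : eqType) (s : seq T) (f : nat -> nat) : uniq s ->
  [seq f (index b s) | b <- s] = [seq f i | i <- iota 0 (size s)].
Proof.
case: s => // x s s_uniq; apply: (@eq_from_nth _ 0); rewrite !size_map ?size_iota //.
move=> i lt_i; rewrite (nth_map x) // (nth_map 0) ?size_iota //.
by rewrite index_uniq // nth_iota.
Qed.

Lemma sumn_takeS (s : seq nat) m : sumn (take m.+1 s) = sumn (take m s) + nth 0 s m.
Proof.
have [lt_m|le_m] := ltnP m (size s).
  by rewrite (take_nth 0) // sumn_rcons.
by rewrite !take_oversize ?nth_default ?addn0 // ltnW.
Qed.

Lemma sumn_take_leq (s : seq nat) : {homo (fun m => sumn (take m s)) : m p / m <= p}.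
Proof.
by apply: homo_leq => [//|m p q /leq_trans|m]; [apply|rewrite sumn_takeS leq_addr].
Qed.

Lemma sumn_take_le (s : seq nat) m : sumn (take m s) <= sumn s.
Proof. by rewrite -{2}(cat_take_drop m s) sumn_cat leq_addr. Qed.

(** The numbers with index [m] form a block of length [nth 0 s m], and the blocks follow one
    another. *)
Lemma partial_sum_ltn (s : seq nat) m p x y :
    0 < x <= nth 0 s m -> 0 < y <= nth 0 s p ->
  (sumn (take m s) + x < sumn (take p s) + y) = (m < p) || (m == p) && (x < y).
Proof.
move=> x_le y_le; have [lt_mp|lt_pm|->] /= := ltngtP m p.
- by have := sumn_take_leq s lt_mp; rewrite sumn_takeS; lia.
- by have := sumn_take_leq s lt_pm; rewrite sumn_takeS; lia.
by rewrite ltn_add2l.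
Qed.

(** * Columns of the diagram of a peak composition and the labelings of its boxes *)

Section PeakCompositions.
Variables (n : nat) (a : seq nat).
Hypothesis (n_gt0 : 0 < n) (a_comp : composition n a) (a_peak : peak a).
Implicit Types b c d : box.

Local Notation l := (size a).
Local Notation boxes := (tcd_seq a).

Lemma part_gt0 y : 0 < y <= l -> 0 < part a y.
Proof.
move=> y_le; rewrite lt0n; apply: contraNneq (proj1 a_comp) => <-.
by case: y y_le => // y y_le; apply: mem_nth.
Qed.

Lemma part_gt1 y : 0 < y < l -> 1 < part a y.
Proof. by move=> y_lt; have := a_peak y_lt; have := @part_gt0 y; lia. Qed.

Lemma size_comp_gt0 : 0 < l.
Proof. by move: n_gt0; rewrite -(proj2 a_comp); case: a. Qed.

Lemma mem_boxes x y : ((x, y) \in boxes) = (0 < y <= l) && (0 < x <= part a y).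
Proof.
apply/allpairsPdep/idP => [[i [j [hi hj [-> ->]]]]|h].
  by move: hi hj; rewrite !mem_iota; lia.
by exists y, x; rewrite !mem_iota; split=> //; lia.
Qed.

Lemma boxes_uniq : uniq boxes.
Proof.
apply: allpairs_uniq_dep => [|i _|]; rewrite ?iota_uniq //.
by move=> [i j] [i' j'] _ _ /= [-> ->].
Qed.

Lemma size_boxes : size boxes = n.
Proof.
rewrite size_allpairs_dep -(proj2 a_comp); congr sumn.
apply: (@eq_from_nth _ 0); rewrite size_map size_iota // => i lt_i.
by rewrite (nth_map 0) ?size_iota // nth_iota // size_iota.
Qed.

(* The boxes of tcd a stand for those of scrG a, row by row. The labelings
   [label_row], [label_col], [label_LT], [label_dr] number them according to the
   row order and the column order of scrG a (see [PlanarPosets]), the reading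
   order LT and the reading order of wdr; the first two are calT and calT''. *)
Definition label_row b := sumn (take b.2.-1 a) + b.1.

Definition label_LT b := sumn (take (l - b.2) (rev a)) + b.1.

Lemma nth_rev_part y : 0 < y <= l -> nth 0 (rev a) (l - y) = part a y.
Proof. by move=> y_le; rewrite nth_rev /part; [congr nth|]; lia. Qed.

Lemma label_row_ltn b c : b \in boxes -> c \in boxes ->
  (label_row b < label_row c) = (b.2 < c.2) || (b.2 == c.2) && (b.1 < c.1).
Proof.
case: b c => x y [x' y']; rewrite !mem_boxes => b_in c_in.
by rewrite /label_row /= partial_sum_ltn -/(part a _); lia.
Qed.

Lemma label_LT_ltn b c : b \in boxes -> c \in boxes ->
  (label_LT b < label_LT c) = (c.2 < b.2) || (b.2 == c.2) && (b.1 < c.1).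
Proof.
case: b c => x y [x' y']; rewrite !mem_boxes => b_in c_in.
by rewrite /label_LT /= partial_sum_ltn ?nth_rev_part; lia.
Qed.

Lemma labeling_row : labeling boxes n label_row.
Proof.
apply: labeling_of_inj boxes_uniq size_boxes _ _ => [b c b_in c_in E|[x y]].
  have := label_row_ltn b_in c_in; have := label_row_ltn c_in b_in; rewrite E ltnn.
  by case: (b) (c) => ? ? [? ?] /= *; congr (_, _); lia.
rewrite mem_boxes /label_row /= => b_in; have := sumn_take_le a y.
rewrite -{1}(prednK (_ : 0 < y)); last by lia.
by rewrite sumn_takeS -/(part a y) (proj2 a_comp); lia.
Qed.

Lemma labeling_LT : labeling boxes n label_LT.
Proof.
apply: labeling_of_inj boxes_uniq size_boxes _ _ => [b c b_in c_in E|[x y]].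
  have := label_LT_ltn b_in c_in; have := label_LT_ltn c_in b_in; rewrite E ltnn.
  by case: (b) (c) => ? ? [? ?] /= *; congr (_, _); lia.
rewrite mem_boxes /label_LT /= => b_in; have := sumn_take_le (rev a) (l - y).+1.
by rewrite sumn_takeS nth_rev_part ?sumn_rev ?(proj2 a_comp); lia.
Qed.

(* The column of the scrG-box corresponding to the box b of tcd a. *)
Definition col b :=
  if b.2 == l then l + b.1 - 1
  else if b.1 <= 2 then b.2 + b.1 - 1 else kj a b.2 + b.1.

(** The parts strictly between [y] and [y'] are not the last one, so each is at least 2; this
    controls the truncated subtraction in [kj]. *)
Lemma sum_parts_ge y y' : 0 < y -> y < y' -> y' <= l ->
  (y' - y.+1).*2 + part a y' + \sum_(y'.+1 <= i < l.+1) part a i <=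
    \sum_(y.+1 <= i < l.+1) part a i.
Proof.
elim: y' => // y' IHy' y_gt0; rewrite ltnS leq_eqVlt => /orP[/eqP -> |lt_y] le_y'.
  by rewrite subnn [leqRHS]big_ltn.
have := IHy' y_gt0 lt_y (ltnW le_y').
by rewrite [X in _ + X <= _]big_ltn //; have := @part_gt1 y'; lia.
Qed.

(** The tail of row [y] starts in column [kj a y + 3], so the tail of a higher row [y'] ends before
    it. *)
Lemma kj_leq y y' : 0 < y -> y < y' -> y' < l -> kj a y' + part a y' <= kj a y + 2.
Proof.
move=> y_gt0 lt_y lt_y'; have := sum_parts_ge y_gt0 lt_y (ltnW lt_y').
have := sum_parts_ge (ltn_trans y_gt0 lt_y) lt_y' (leqnn l); rewrite big_geq //.
have := @part_gt0 l; rewrite /kj; lia.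
Qed.

(** The top row ends in column [l + part a l - 1], before the tail of any other row starts. *)
Lemma kj_last y : 0 < y < l -> l + part a l <= kj a y + 3.
Proof.
move=> /andP[y_gt0 lt_y]; have := sum_parts_ge y_gt0 lt_y (leqnn l).
by rewrite big_geq // /kj; lia.
Qed.

(** The boxes of [scrG a] beyond column [l], which are alone in their columns. The others form a
    staircase: row y has columns y and y + 1, only column y for the top row. *)
Definition tail_box b := (2 < b.1) || (b.1 == 2) && (b.2 == l).

(** The second bound separates the third and later boxes of the rows from (2, l), which lies in
    column [l.+1] when the last part is not 1. *)
Lemma col_tail b : b \in boxes -> tail_box b ->
  l < col b /\ (2 < b.1 -> part a l != 1 -> l.+1 < col b).
Proof.
case: b => x y; rewrite mem_boxes /tail_box /col /= => b_in b_tail.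
have := @kj_last y; have := @part_gt0 l; have := size_comp_gt0; move: b_in b_tail.
case: (eqVneq y l) => [->|ne] /=; first by lia.
by case: (leqP x 2) => ?; lia.
Qed.

Lemma col_head b : b \in boxes -> ~~ tail_box b -> col b = b.2 + b.1 - 1.
Proof.
case: b => x y; rewrite mem_boxes /tail_box /col /= => b_in b_tail.
move: b_in b_tail; case: (eqVneq y l) => [->|ne]; first by lia.
by case: (leqP x 2) => ?; lia.
Qed.

Lemma col_tail_ltn b c : b \in boxes -> c \in boxes -> tail_box b -> tail_box c ->
  (c.2 < b.2) || (b.2 == c.2) && (b.1 < c.1) -> col b < col c.
Proof.
case: b c => x y [x' y']; rewrite !mem_boxes /tail_box /col /= => b_in c_in tb tc lt.
case: (eqVneq y l) b_in tb lt => [->|ne] b_in tb lt.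
  case: (eqVneq y' l) tc lt => [->|ne'] tc lt; first by lia.
  have x'_gt2 : 2 < x' by lia.
  have lt_y' : 0 < y' < l by lia.
  by rewrite (leqNgt x') x'_gt2 /=; have := kj_last lt_y'; lia.
have ne' : y' != l by lia.
have [x_gt2 x'_gt2] : 2 < x /\ 2 < x' by move: tb tc; rewrite (negPf ne'); lia.
rewrite (negPf ne') (leqNgt x) (leqNgt x') x_gt2 x'_gt2 /=.
case/orP: lt => [lt_y|/andP[/eqP <- lt_x]]; last by rewrite ltn_add2l.
have [y'_gt0 lt_yl] : 0 < y' /\ y < l by lia.
have := kj_leq y'_gt0 lt_y lt_yl; lia.
Qed.

(** Columns of tail boxes increase along the reading order LT, the order in which both [rest_boxes]
    and [rest_dr] are sorted. *)
Lemma col_tail_cmp b c : b \in boxes -> c \in boxes -> tail_box b -> tail_box c ->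
  (col b < col c) = (c.2 < b.2) || (b.2 == c.2) && (b.1 < c.1).
Proof.
move=> b_in c_in tb tc; apply/idP/idP; last exact: col_tail_ltn.
apply: contraTT => nlt; rewrite -leqNgt.
have [->//|ne] := eqVneq b c; apply/ltnW/col_tail_ltn => //.
move: ne nlt; rewrite [b]surjective_pairing [c]surjective_pairing xpair_eqE /=; lia.
Qed.

Lemma col_tail_eq b c : b \in boxes -> c \in boxes -> tail_box b -> tail_box c ->
  (col b == col c) = (b == c).
Proof.
move=> b_in c_in tb tc; rewrite eqn_leq (leqNgt (col b)) (leqNgt (col c)) !col_tail_cmp //.
rewrite [b]surjective_pairing [c]surjective_pairing xpair_eqE /=; lia.
Qed.

Definition label_col b :=
  if b.1 == 1 then b.2.*2.-1 else if b.1 == 2 then b.2.*2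
  else l.*2 - (part a l == 1) + (index b (rest_boxes a)).+1.

Definition rest_dr := [seq b <- sort orderLT (tcd a) | b \notin dr_head a].

(** The head of [wdr] has (1, j) in place 2j - 2 and (2, j) in place 2j + 1; [maxn 1] corrects the
    place of (1, 1). *)
Definition label_dr b :=
  if tail_box b then l.*2.-1 + (index b rest_dr).+1
  else if b.1 == 1 then maxn 1 (b.2.*2 - 2) else b.2.*2.+1.

Lemma tcd_perm : perm_eq (tcd a) boxes.
Proof.
apply: uniq_perm => //; first exact: boxes_uniq.
by move=> b; rewrite in_fset_.
Qed.

Lemma mem_rest_boxes b : (b \in rest_boxes a) = (2 < b.1) && (b \in boxes).
Proof. by rewrite mem_sort mem_filter. Qed.

Lemma mem_dr_head b : b \in dr_head a = (b \in boxes) && ~~ tail_box b.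
Proof.
have l0 := size_comp_gt0; case: b => x y.
rewrite mem_boxes /tail_box /dr_head in_cons /=; apply/idP/idP.
  case/orP=> [/eqP[-> ->]|/flatten_mapP[j]].
    by have := @part_gt0 1; lia.
  rewrite mem_iota !inE => j_le /orP[]/eqP[-> ->].
    by have := @part_gt0 j; lia.
  by have := @part_gt1 j.-1; lia.
move=> h; have [/eqP-> //|ne] := boolP ((x, y) == (1, 1)).
apply/flatten_mapP; move: ne; rewrite xpair_eqE => ne.
have [x1|x2] := eqVneq x 1.
  by exists y; [rewrite mem_iota; lia|rewrite x1 !inE eqxx].
exists y.+1; first by rewrite mem_iota; lia.
by rewrite !inE !xpair_eqE; lia.
Qed.

Lemma mem_rest_dr b : (b \in rest_dr) = (b \in boxes) && tail_box b.
Proof.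
rewrite mem_filter mem_sort mem_dr_head (perm_mem tcd_perm).
by case: (b \in boxes); rewrite //= ?andbF ?negbK ?andbT.
Qed.

Lemma rest_dr_uniq : uniq rest_dr.
Proof. by rewrite filter_uniq // sort_uniq (perm_uniq tcd_perm) boxes_uniq. Qed.

Lemma rest_boxes_uniq : uniq (rest_boxes a).
Proof. by rewrite sort_uniq filter_uniq // boxes_uniq. Qed.

Lemma index_rest_boxes_ltn b c : b \in rest_boxes a -> c \in rest_boxes a ->
  (index b (rest_boxes a) < index c (rest_boxes a)) = ~~ orderLT c b.
Proof.
apply: (index_ltn_sorted orderLT_trans orderLT_total orderLT_anti).
exact: sort_sorted orderLT_total _.
Qed.

Lemma index_rest_dr_ltn b c : b \in rest_dr -> c \in rest_dr ->
  (index b rest_dr < index c rest_dr) = ~~ orderLT c b.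
Proof.
apply: (index_ltn_sorted orderLT_trans orderLT_total orderLT_anti).
apply: (sorted_filter orderLT_trans); exact: sort_sorted orderLT_total _.
Qed.

(** Boxes (x, y) with x at most 2 have label 2y + x - 2 and column y + x - 1: for 1 < c <= l, column
    c holds (2, c - 1) below (1, c), labelled 2c - 2 and 2c - 1. The remaining boxes have one column
    each, numbered in the reading order. *)
Lemma label_col_ltn b c : b \in boxes -> c \in boxes ->
  (label_col b < label_col c) = (col b < col c) || (col b == col c) && (b.2 < c.2).
Proof.
have small (d : box) : d \in boxes -> d.1 <= 2 -> [/\ label_col d = d.2.*2 + d.1 - 2,
    col d = d.2 + d.1 - 1, 0 < d.1, 0 < d.2 & label_col d <= l.*2 - (part a l == 1)].
  case: d => x y; rewrite mem_boxes => d_in /= le_x.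
  have E : label_col (x, y) = y.*2 + x - 2.
    by rewrite /label_col /=; move: d_in; do !case: eqP => [->|?]; lia.
  rewrite E; split; try (move: d_in; rewrite /=; lia).
    by rewrite /col /= le_x; move: d_in; case: (eqVneq y l) => [->|?]; lia.
  by move: d_in; case: (eqVneq y l) => [->|?] /=; lia.
have tail (d : box) : 2 < d.1 ->
    label_col d = l.*2 - (part a l == 1) + (index d (rest_boxes a)).+1.
  by rewrite /label_col; case: d => x y /=; do 2?case: eqP => [->|?].
move=> b_in c_in; have l0 := size_comp_gt0.
have [le_b|lt_b] := leqP b.1 2; have [le_c|lt_c] := leqP c.1 2.
- by have [-> -> ? ? _] := small _ b_in le_b; have [-> -> ? ? _] := small _ c_in le_c; lia.
- have [EL EC _ _ le] := small _ b_in le_b; rewrite (tail c) //.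
  have [] := col_tail c_in; first by rewrite /tail_box lt_c.
  by move: le; rewrite EL EC => ? ? /(_ lt_c); case: eqP => /=; lia.
- have [EL EC _ _ le] := small _ c_in le_c; rewrite (tail b) //.
  have [] := col_tail b_in; first by rewrite /tail_box lt_b.
  by move: le; rewrite EL EC => ? ? /(_ lt_b); case: eqP => /=; lia.
rewrite !tail // ltn_add2l ltnS index_rest_boxes_ltn ?mem_rest_boxes ?lt_b ?lt_c //.
rewrite col_tail_cmp ?col_tail_eq /tail_box ?lt_b ?lt_c //.
have [->|_] := eqVneq b c; rewrite /orderLT; lia.
Qed.

(** The two boxes of a staircase column receive the same two labels as in [label_col], in the
    opposite order. *)
Lemma label_dr_ltn b c : b \in boxes -> c \in boxes ->
  (label_dr b < label_dr c) = (col b < col c) || (col b == col c) && (c.2 < b.2).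
Proof.
have small (d : box) : d \in boxes -> ~~ tail_box d ->
    [/\ label_dr d = if d.1 == 1 then maxn 1 (d.2.*2 - 2) else d.2.*2.+1,
    col d = d.2 + d.1 - 1, 0 < d.1 <= 2, 0 < d.2 & (d.1 == 2) ==> (d.2 < l)].
  move=> d_in d_tail; rewrite col_head // /label_dr (negPf d_tail).
  case: d d_in d_tail => x y; rewrite mem_boxes /tail_box /=.
  by move=> *; split=> //; lia.
have small_le (d : box) : d \in boxes -> ~~ tail_box d -> label_dr d < l.*2 /\ col d <= l.
  move=> d_in d_tail; have [-> -> d1 d2 /implyP d3] := small _ d_in d_tail.
  have d2_le : d.2 <= l by case: d d_in {d_tail d1 d2 d3} => x y; rewrite mem_boxes /=; lia.
  have [d1E|ne] := eqVneq d.1 1; first by lia.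
  by have := d3 (_ : d.1 == 2); lia.
have tail (d : box) : tail_box d -> label_dr d = l.*2.-1 + (index d rest_dr).+1.
  by rewrite /label_dr => ->.
move=> b_in c_in; have l0 := size_comp_gt0.
have [tb|hb] := boolP (tail_box b); have [tc|hc] := boolP (tail_box c).
- rewrite !tail // ltn_add2l ltnS index_rest_dr_ltn ?mem_rest_dr ?b_in ?c_in //.
  rewrite col_tail_cmp ?col_tail_eq //.
  by have [->|_] := eqVneq b c; rewrite /orderLT; lia.
- have [? ?] := small_le _ c_in hc; have [? _] := col_tail b_in tb.
  by rewrite (tail b) //; lia.
- have [? ?] := small_le _ b_in hb; have [? _] := col_tail c_in tc.
  by rewrite (tail c) //; lia.
have [-> -> b1 b2 _] := small _ b_in hb; have [-> -> c1 c2 _] := small _ c_in hc.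
by do 2!case: eqP => [?|?]; lia.
Qed.

Definition head_col :=
  flatten [seq [:: (1, j); (2, j)] | j <- iota 1 l.-1] ++
  (1, l) :: nseq (part a l != 1) (2, l).

Lemma map_label_head_col :
  [seq label_col b | b <- head_col] = iota 1 (l.*2 - (part a l == 1)).
Proof.
have pairs m : [seq label_col b | b <- flatten [seq [:: (1, j); (2, j)] | j <- iota 1 m]]
    = iota 1 m.*2.
  elim: m => // m IHm; rewrite -[X in iota 1 X]addn1 iotaD map_cat flatten_cat map_cat IHm.
  by rewrite doubleS -[m.*2.+2]addn2 iotaD; congr (_ ++ _).
rewrite map_cat pairs; have l0 := size_comp_gt0.
have -> : l.*2 - (part a l == 1) = l.-1.*2 + (part a l != 1).+1 by case: eqP => /=; lia.
rewrite iotaD /= map_nseq /label_col /=; congr (_ ++ _ :: _); first by lia.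
by case: (_ != _) => //=; congr [:: _]; lia.
Qed.

Lemma mem_head_col b : (b \in head_col) = (b \in boxes) && (b.1 <= 2).
Proof.
have l0 := size_comp_gt0; have pl := @part_gt0 l; case: b => x y.
rewrite mem_boxes mem_cat in_cons /=; apply/idP/idP.
  case/or3P=> [/flatten_mapP[j]|/eqP[-> ->]|].
  - rewrite mem_iota !inE => j_le; have := @part_gt1 j.
    by move=> ? /orP[]/eqP[-> ->]; lia.
  - by lia.
  by rewrite mem_nseq => /andP[? /eqP[-> ->]]; lia.
move=> h; have [yl|ney] := eqVneq y l.
  move: h; rewrite yl mem_nseq !xpair_eqE eqxx !andbT => h.
  by apply/orP; right; lia.
apply/orP; left; apply/flatten_mapP; exists y; first by rewrite mem_iota; lia.
by rewrite !inE !xpair_eqE eqxx; lia.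
Qed.

Lemma labeling_col : labeling boxes n label_col.
Proof.
have head_uniq : uniq head_col.
  by apply: (@map_uniq _ _ label_col); rewrite map_label_head_col iota_uniq.
have A_perm : perm_eq (head_col ++ rest_boxes a) boxes.
  apply: uniq_perm => [||b]; [|exact: boxes_uniq|].
    rewrite cat_uniq head_uniq rest_boxes_uniq andbT; apply/hasPn => b.
    rewrite mem_rest_boxes => /andP[lt_b _]; change (b \notin head_col).
    by rewrite mem_head_col leqNgt lt_b andbF.
  by rewrite mem_cat mem_rest_boxes mem_head_col leqNgt andbC -andb_orl orNb.
apply: (labeling_of_listing A_perm); set N := l.*2 - (part a l == 1).
have -> : n = N + size (rest_boxes a).
  rewrite -size_boxes -(perm_size A_perm) size_cat -(size_map label_col head_col).
  by rewrite map_label_head_col size_iota.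
rewrite map_cat map_label_head_col iotaD -/N; congr (_ ++ _).
rewrite -[RHS]/(iota (1 + N) _) -[X in iota X _]addn0 iotaDl.
rewrite -(map_index_uniq (fun i => 1 + N + i) rest_boxes_uniq).
apply/eq_in_map => b; rewrite mem_rest_boxes => /andP[b_tail _].
by rewrite /label_col -/N; do 2![case: eqP => [E|_]; first by rewrite E in b_tail]; lia.
Qed.

Lemma map_label_dr_head : [seq label_dr b | b <- dr_head a] = iota 1 l.*2.-1.
Proof.
have pairs m : m < l -> [seq label_dr b |
    b <- flatten [seq [:: (1, j); (2, j.-1)] | j <- iota 2 m]] = iota 2 m.*2.
  elim: m => // m IHm lt_m.
  rewrite -[X in iota 2 X]addn1 iotaD map_cat flatten_cat map_cat IHm; last exact: ltnW.
  rewrite doubleS -[m.*2.+2]addn2 iotaD; congr (_ ++ _).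
  rewrite /= /label_dr /tail_box /=; have -> : (m.+1 == l) = false by lia.
  by congr (_ :: _ :: _); lia.
have l0 := size_comp_gt0; rewrite /dr_head /= pairs; last by lia.
have -> : l.*2.-1 = l.-1.*2.+1 by lia.
by rewrite /label_dr /tail_box /=.
Qed.

Definition listing_dr := dr_head a ++ rest_dr.

Lemma listing_dr_perm : perm_eq listing_dr boxes.
Proof.
have head_uniq : uniq (dr_head a).
  by apply: (@map_uniq _ _ label_dr); rewrite map_label_dr_head iota_uniq.
apply: uniq_perm => [||b]; [|exact: boxes_uniq|].
  rewrite cat_uniq head_uniq rest_dr_uniq andbT; apply/hasPn => b.
  rewrite mem_rest_dr => /andP[_ tb]; change (b \notin dr_head a).
  by rewrite mem_dr_head tb andbF.
by rewrite mem_cat mem_rest_dr mem_dr_head -andb_orr orNb andbT.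
Qed.

Lemma map_label_listing_dr : [seq label_dr b | b <- listing_dr] = iota 1 n.
Proof.
have -> : n = l.*2.-1 + size rest_dr.
  rewrite -size_boxes -(perm_size listing_dr_perm) size_cat.
  by rewrite -(size_map label_dr (dr_head a)) map_label_dr_head size_iota.
rewrite map_cat map_label_dr_head iotaD; congr (_ ++ _).
rewrite -[X in iota X _]addn0 iotaDl.
rewrite -(map_index_uniq (fun i => 1 + l.*2.-1 + i) rest_dr_uniq).
apply/eq_in_map => b; rewrite mem_rest_dr => /andP[_ b_tail].
by rewrite /label_dr b_tail; lia.
Qed.

Lemma labeling_dr : labeling boxes n label_dr.
Proof. exact: labeling_of_listing listing_dr_perm map_label_listing_dr. Qed.

(** * The boxes of the diagram and of its reflection, in column order *)

Definition lift_box b : box := (col b, b.2).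

Lemma scrG_rows :
  flatten [seq rowG a j | j <- iota 1 l] = [seq lift_box b | b <- boxes].
Proof.
rewrite map_flatten -map_comp; congr flatten; apply/eq_in_map => y.
rewrite mem_iota /rowG /= -map_comp => y_le.
case: eqP => [yl|/eqP ne].
  by apply: eq_map => x; rewrite /= /lift_box /col /= yl eqxx.
(* A row below the top one consists of two staircase boxes and a tail, as in [rowG]. *)
have pE : part a y = 2 + (part a y - 2) by have := @part_gt1 y; lia.
rewrite [in RHS]pE iotaD map_cat /= /lift_box /col /= (negPf ne) /=.
congr ((_, _) :: (_, _) :: _); try lia.
apply/eq_in_map => x; rewrite mem_iota /= (negPf ne) => x_ge.
by rewrite leqNgt; have -> : 2 < x by lia.
Qed.

Lemma mem_scrG b : (b \in scrG a) = (b \in [seq lift_box c | c <- boxes]).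
Proof. by rewrite in_fset_ /= scrG_rows. Qed.

Local Notation D := (flip_diagram (scrG a)).
Local Notation relab := (relabeling (0, 0) boxes n).

Definition col_box (i : 'I_n) : box := at_label (0, 0) boxes label_col i.+1.

Definition flipped_box (i : 'I_n) : box :=
  flip_box (height (scrG a)) (lift_box (col_box i)).

Lemma at_labelT F (i : 'I_n) : labeling boxes n F ->
  at_label (0, 0) boxes F i.+1 \in boxes /\
  F (at_label (0, 0) boxes F i.+1) = i.+1.
Proof. by move=> F_lab; apply: (at_labelP (0, 0) F_lab); apply: ltn_ord. Qed.

Lemma col_box_in i : col_box i \in boxes.
Proof. by have [] := at_labelT i labeling_col. Qed.

Lemma col_boxK i : label_col (col_box i) = i.+1.
Proof. by have [] := at_labelT i labeling_col. Qed.

Lemma col_box_surj b : b \in boxes -> exists i, col_box i = b.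
Proof.
move=> b_in; have := labeling_bounds labeling_col b_in.
case E: (label_col b) => [//|k] lt_k.
by exists (Ordinal lt_k); rewrite /col_box /= -E (at_labelK _ labeling_col).
Qed.

Lemma lift_box_inj : {in boxes &, injective lift_box}.
Proof.
move=> b c b_in c_in [Ecol Erow]; apply: (labeling_inj labeling_col) => //.
apply/eqP; rewrite eqn_leq (leqNgt (label_col b)) (leqNgt (label_col c)).
by rewrite !label_col_ltn // Ecol Erow !ltnn andbF.
Qed.

Lemma col_box_height i : (col_box i).2 <= height (scrG a).
Proof.
have : lift_box (col_box i) \in scrG a by rewrite mem_scrG map_f ?col_box_in.
exact: height_leq.
Qed.

Lemma flipped_box_inj : injective flipped_box.
Proof.
move=> i j /(congr1 (flip_box (height (scrG a)))).
rewrite !flip_boxK ?col_box_height // => /lift_box_inj E.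
by apply: ord_inj; apply: succn_inj; rewrite -!col_boxK E ?col_box_in.
Qed.

Lemma flipped_box_mem : D =i [seq flipped_box i | i <- enum 'I_n].
Proof.
move=> b; apply/imfsetP/mapP => [[c /= c_in ->]|[i _ ->]].
  move: c_in; rewrite mem_scrG => /mapP[d /col_box_surj[i <-] ->].
  by exists i; rewrite ?mem_enum.
by exists (lift_box (col_box i)); rewrite //= mem_scrG map_f ?col_box_in.
Qed.

Lemma flipped_box_sorted (i j : 'I_n) : i <= j -> orderTL (flipped_box i) (flipped_box j).
Proof.
rewrite leqNgt -ltnS -!col_boxK label_col_ltn ?col_box_in // /orderTL /=.
by lia.
Qed.

Local Notation Y := (fun i => (flip_box (height D) (flipped_box i)).2).

(** Two reflections restore the vertical order, so the coordinates used for the reflected diagram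
    compare boxes as in [scrG a] itself. *)
Lemma flipped_row_ltn i j : (Y i < Y j) = ((col_box i).2 < (col_box j).2).
Proof.
have := height_leq (bx_mem flipped_box_mem i).
have := height_leq (bx_mem flipped_box_mem j).
have := col_box_height i; have := col_box_height j.
by rewrite /flipped_box /flip_box /=; lia.
Qed.

Lemma flipped_row_eq i j : (Y i == Y j) = ((col_box i).2 == (col_box j).2).
Proof.
have ltE := flipped_row_ltn; cbv beta in ltE.
by rewrite 2!eqn_leq (leqNgt (Y i)) (leqNgt (Y j)) !ltE -!leqNgt.
Qed.

Lemma col_head_leq b : b \in boxes -> ~~ tail_box b -> col b <= l.
Proof.
move=> b_in hb; rewrite col_head //; move: b_in hb.
by case: b => x y; rewrite mem_boxes /tail_box /=; lia.
Qed.

Lemma col_row_ltn b c : b \in boxes -> c \in boxes -> b.2 = c.2 ->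
  (col b < col c) = (b.1 < c.1).
Proof.
have tail_gt (d d' : box) : d \in boxes -> d' \in boxes -> d.2 = d'.2 ->
    tail_box d -> ~~ tail_box d' -> (col d' < col d) && (d'.1 < d.1).
  move=> d_in d'_in E td hd'; have [lt _] := col_tail d_in td.
  rewrite (leq_ltn_trans (col_head_leq d'_in hd') lt).
  case: d d' d_in d'_in E td hd' {lt} => x y [x' y'].
  by rewrite !mem_boxes /tail_box /=; lia.
move=> b_in c_in E.
have [tb|hb] := boolP (tail_box b); have [tc|hc] := boolP (tail_box c).
- by rewrite col_tail_cmp // E ltnn eqxx.
- by have := tail_gt _ _ b_in c_in E tb hc; lia.
- by have := tail_gt _ _ c_in b_in (esym E) tc hb; lia.
by rewrite !col_head // E; case: b c b_in c_in {E hb hc} => x y [x' y'];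
  rewrite !mem_boxes /=; lia.
Qed.

(** No box lies strictly NE of a tail box, so [b] is in the staircase and not in the top row. The
    required box is its right neighbour (2, y) if [b] is (1, y), and the box (1, y + 1) just above
    it if [b] is (2, y). *)
Lemma between_boxes b c : b \in boxes -> c \in boxes -> col b < col c -> b.2 < c.2 ->
  exists d, [/\ d \in boxes, d != b, d != c, col b <= col d <= col c
              & b.2 <= d.2 <= c.2].
Proof.
move=> b_in c_in lt_col lt_row.
have [tb|hb] := boolP (tail_box b).
  have [col_b _] := col_tail b_in tb.
  have tc : tail_box c.
    by apply: contraLR lt_col => /(col_head_leq c_in); lia.
  have lt_LT : (b.2 < c.2) || (c.2 == b.2) && (c.1 < b.1) by rewrite lt_row.
  by have := col_tail_ltn c_in b_in tc tb lt_LT; lia.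
move: lt_col; rewrite col_head //.
case: b b_in hb lt_row => x y; rewrite mem_boxes /tail_box /= => b_in hb lt_row lt_col.
have c2_le : c.2 <= l by case: c c_in {lt_row lt_col} => x' y'; rewrite mem_boxes /=; lia.
have lt_y : 0 < y < l by lia.
have [x1|x2] := eqVneq x 1.
  have d_in : (2, y) \in boxes by rewrite mem_boxes; have := part_gt1 lt_y; lia.
  exists (2, y); rewrite d_in x1; split=> //=; try lia.
    by apply: contraTneq lt_row => <-; rewrite ltnn.
  by rewrite col_head // /tail_box /=; move: lt_col; rewrite x1; lia.
have d_in : (1, y.+1) \in boxes by rewrite mem_boxes; have := @part_gt0 y.+1; lia.
have col_d : col (1, y.+1) = y.+1 by rewrite col_head // /tail_box /=; lia.
exists (1, y.+1); rewrite d_in col_d; split=> //=; try lia.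
- by rewrite xpair_eqE; lia.
apply: contraTneq lt_col => <-; rewrite col_d; lia.
Qed.

(** * The ends of the two intervals as relabelings *)

Lemma map_label_sort_LT : [seq label_LT b | b <- sort orderLT (tcd a)] = iota 1 n.
Proof.
apply: (sorted_eq leq_trans anti_leq) => //; last first.
- apply: perm_trans (perm_map _ _) labeling_LT.
  by rewrite perm_sort tcd_perm.
- exact: iota_sorted.
rewrite sorted_map.
apply: (@sub_in_sorted _ (mem boxes) orderLT) (sort_sorted orderLT_total _).
  move=> b c b_in c_in; rewrite /= leqNgt label_LT_ltn // /orderLT; lia.
by apply/allP => b; rewrite mem_sort (perm_mem tcd_perm).
Qed.

Lemma calTE b : b \in boxes -> calT a b = label_row b.
Proof. by move=> b_in; rewrite /calT fsfun_fun (perm_mem tcd_perm) b_in. Qed.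

Lemma calT''E b : b \in boxes -> calT'' a b = label_col b.
Proof. by move=> b_in; rewrite /calT'' fsfun_fun (perm_mem tcd_perm) b_in. Qed.

Lemma finsupp_calT'' : finsupp (calT'' a) = tcd a.
Proof.
apply/fsetP => b; apply/idP/idP; first by move/(fsubsetP (finsupp_sub _ _ _)).
rewrite (perm_mem tcd_perm) => b_in; rewrite mem_finsupp calT''E // -lt0n.
by case/andP: (labeling_bounds labeling_col b_in).
Qed.

Lemma perm_of_wLT : perm_of_word n (wLT (calT'' a)) = relab label_LT label_col.
Proof.
have sub b : b \in sort orderLT (tcd a) -> b \in boxes.
  by rewrite mem_sort (perm_mem tcd_perm).
have -> : wLT (calT'' a) = [seq label_col b | b <- sort orderLT (tcd a)].
  rewrite /wLT finsupp_calT''; apply/eq_in_map => b /sub; exact: calT''E.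
exact: perm_of_word_relabeling labeling_LT sub map_label_sort_LT.
Qed.

Lemma perm_of_wdr : perm_of_word n (wdr a (calT a)) = relab label_dr label_row.
Proof.
have sub b : b \in listing_dr -> b \in boxes by rewrite (perm_mem listing_dr_perm).
have -> : wdr a (calT a) = [seq label_row b | b <- listing_dr].
  by apply/eq_in_map => b /sub; exact: calTE.
exact: perm_of_word_relabeling labeling_dr sub map_label_listing_dr.
Qed.

(** A column with two boxes holds (2, y) and (1, y + 1), with consecutive labels 2y and 2y + 1 in
    [label_col]; reversing all columns is the product of the commuting s_(2y) for 0 < y < l. *)
Lemma w0_evens : w0 (evens n l.-1) = relab label_dr label_col.
Proof.
have ev_gt0 : {in evens n l.-1, forall i : 'I_n, 0 < i}.
  by move=> i; rewrite inE => /andP[].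
(* Both sides are compared through their inverses, whose positions are the indices of
   [label_col]. *)
rewrite -(relabelingV (0, 0) labeling_col labeling_dr).
apply: invg_inj; rewrite invgK w0V //; apply: inversions_inj.
apply/setP => -[i j]; have [lt_ij|le_ji] := ltnP i j; last first.
  by rewrite !inversionsE ltnNge le_ji.
rewrite inversions_w0 // inversionsP // relabeling_ltn ?labeling_col ?labeling_dr //.
rewrite -/(col_box i) -/(col_box j) label_dr_ltn ?col_box_in //.
have : label_col (col_box i) < label_col (col_box j) by rewrite !col_boxK.
rewrite label_col_ltn ?col_box_in // => lt_col.
have -> : (col (col_box j) < col (col_box i)) || (col (col_box j) == col (col_box i))
    && ((col_box i).2 < (col_box j).2) = (col (col_box i) == col (col_box j)).
  by move: lt_col; lia.
apply/forallP/eqP => [ev|Ecol].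
  have ev_k k : i < k <= j -> ~~ odd k && (k <= l.-1.*2).
    move=> k_ij; have lt_k : k < n by have := ltn_ord j; lia.
    by have := ev (Ordinal lt_k); rewrite k_ij inE => /and3P[_ -> ->].
  have /andP[ev_Si le_Si] : ~~ odd i.+1 && (i.+1 <= l.-1.*2).
    by apply: ev_k; rewrite ltnSn.
  (* Otherwise the consecutive labels i + 1 and i + 2 would both be even. *)
  have [jE|ne] := eqVneq (j : nat) i.+1; last first.
    have /andP[] : ~~ odd i.+2 && (i.+2 <= l.-1.*2) by apply: ev_k; lia.
    by rewrite oddS ev_Si.
  have [y yE] : exists y, i.+1 = y.*2.
    by exists i.+1./2; rewrite even_halfK.
  have y_lt : 0 < y < l by move: le_Si; rewrite yE; lia.
  have b_in : (2, y) \in boxes by rewrite mem_boxes; have := part_gt1 y_lt; lia.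
  have c_in : (1, y.+1) \in boxes by rewrite mem_boxes; have := @part_gt0 y.+1; lia.
  have -> : col_box i = (2, y).
    by rewrite /col_box yE -[y.*2]/(label_col (2, y)) (at_labelK _ labeling_col).
  have -> : col_box j = (1, y.+1).
    by rewrite /col_box jE yE -[y.*2.+1]/(label_col (1, y.+1)) (at_labelK _ labeling_col).
  by rewrite !col_head // /tail_box /=; lia.
have lt_row : (col_box i).2 < (col_box j).2 by move: lt_col; rewrite Ecol ltnn eqxx.
have bi := col_box_in i; have bj := col_box_in j.
(* Tail boxes being alone in their columns, two boxes in one column are staircase boxes (2, y) and
   (1, y + 1). *)
have [tb|hb] := boolP (tail_box (col_box i)).
  have [lt_b _] := col_tail bi tb.
  have tc : tail_box (col_box j).
    by apply: contraLR lt_b => /(col_head_leq bj); rewrite -leqNgt Ecol.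
  have := col_tail_eq bi bj tb tc; rewrite Ecol eqxx => /esym/eqP E.
  by move: lt_row; rewrite E ltnn.
have [tc|hc] := boolP (tail_box (col_box j)).
  by have [] := col_tail bj tc; rewrite -Ecol ltnNge col_head_leq.
move: Ecol; rewrite !col_head //; have := col_boxK i; have := col_boxK j.
move: bi bj hb hc lt_row; case: (col_box i) => x y; case: (col_box j) => x' y'.
rewrite !mem_boxes /tail_box /= => bi bj hb hc lt_row Lj Li Ecol k.
have [x2 x1] : x = 2 /\ x' = 1 by lia.
move: Lj Li; rewrite x2 x1 /label_col /= => Lj Li.
by apply/implyP => k_ij; rewrite inE; lia.
Qed.

(** In [label_LT], which starts from the top row, the set of the reversed composition consists of
    the last labels of all rows but the bottom one. Two labels are separated by it exactly when
    their rows differ, and [label_row] reverses the order of the rows. *)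
Lemma w1_set : w1 (set_of_comp n (rev a)) = relab label_LT label_row.
Proof.
apply: inversions_inj; apply/setP => -[i j].
have [lt_ij|le_ji] := ltnP i j; last by rewrite !inversionsE ltnNge le_ji.
rewrite inversions_w1 // inversionsP // relabeling_ltn ?labeling_LT ?labeling_row //.
have [bi Li] := at_labelT i labeling_LT; have [bj Lj] := at_labelT j labeling_LT.
move: (at_label _ _ _ i.+1) (at_label _ _ _ j.+1) bi Li bj Lj => b c bi Li bj Lj.
rewrite label_row_ltn //; have := label_LT_ltn bi bj.
rewrite Li Lj ltnS lt_ij => /esym lt_LT.
case: b c bi Li bj Lj lt_LT => x y [x' y']; rewrite !mem_boxes /label_LT /=.
move=> bi Li bj Lj lt_LT; have l0 := size_comp_gt0.
have -> : (y' < y) || (y' == y) && (x' < x) = (y' < y) by move: lt_LT; lia.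
have Si := sumn_takeS (rev a) (l - y); rewrite nth_rev_part in Si; last by lia.
have Sj := sumn_takeS (rev a) (l - y'); rewrite nth_rev_part in Sj; last by lia.
apply/existsP/idP => [[k /andP[k_ij]]|lt_y].
  rewrite inE => /mapP[m _ kE].
  have {}kE : nat_of_ord k = sumn (take m (rev a)) by exact: kE.
  rewrite ltnNge; apply/negP => ge_y.
  have yE : y = y' by lia.
  have [lt_m|le_m] := ltnP (l - y') m.
    by have := sumn_take_leq (rev a) lt_m; rewrite -kE Sj; lia.
  by have := sumn_take_leq (rev a) le_m; rewrite -kE; move: Li; rewrite yE; lia.
(* The separating label is the last one of the row just above the second box. *)
have k_lt : sumn (take (l - y') (rev a)) < n by have := ltn_ord j; lia.
exists (Ordinal k_lt); rewrite /= inE /=; apply/andP; split.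
  have : (l - y).+1 <= l - y' by lia.
  by move/(sumn_take_leq (rev a)); lia.
by apply: map_f; rewrite mem_iota size_rev; lia.
Qed.

Lemma peak_class :
  let I0 := intL (perm_of_word n (wLT (calT'' a))) (w1 (set_of_comp n (rev a))) in
  let C := classD I0 in
  let Gx := flip_diagram (scrG a) in
  ((forall I : {set 'S_n},
      C I <-> exists2 T : filling, ST Gx T &
                I = SigmaL (@poset_of n (flip_filling T))) /\
   is_min (@le_int n) C
     (intL (w0 (evens n l.-1)) (perm_of_word n (wdr a (calT a)))) /\
   is_max (@le_int n) C I0) /\
  (exists f : {set 'S_n} -> filling,
     poset_iso C (@le_int n) (ST Gx) (le_ST n) f).
Proof.
have [lC [lR [lDR lLT]]] := (labeling_col, (labeling_row, (labeling_dr, labeling_LT))).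
rewrite perm_of_wLT w1_set w0_evens perm_of_wdr.
(* Both intervals read [label_col] and [label_row] along one labeling [F], so both are of the form
   [NEint]: [label_dr] gives the minimum of the class and [label_LT] its maximum. *)
have NE F : labeling boxes n F ->
    intL (relab F label_col) (relab F label_row) =
    NEint (relab label_col label_row) (relab label_col F).
  by move=> F_lab; rewrite /NEint relabelingV // relabeling_comp.
rewrite !NE //.
have rE := flipped_row_ltn; have rEq := flipped_row_eq; cbv beta in rE, rEq.
have bI := col_box_in.
have at_col (i : 'I_n) : at_label (0, 0) boxes label_col i.+1 = col_box i by [].
have rowE b c : b \in boxes -> c \in boxes ->
    (b.2 == c.2) && (b.1 < c.1) = (b.2 == c.2) && (col b < col c).
  by move=> b_in c_in; case: eqP => //= E; rewrite col_row_ltn.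
apply: (diagram_class flipped_box_inj flipped_box_mem flipped_box_sorted).
- by move=> i j; rewrite rE rEq relabeling_ltn // !at_col label_row_ltn // rowE.
- move=> i j ltX; rewrite rE => ltY.
  have [d [/col_box_surj[k <-] ni nj leX leY]] := between_boxes (bI i) (bI j) ltX ltY.
  exists k; split=> //; try by apply: contraNneq ni => ->.
    by apply: contraNneq nj => ->.
  by rewrite !(leqNgt (flip_box _ _).2) !rE -!leqNgt.
- by move=> i j; rewrite rE relabeling_ltn // !at_col label_dr_ltn.
by move=> i j; rewrite rE rEq relabeling_ltn // !at_col label_LT_ltn // rowE.
Qed.

End PeakCompositions.

Theorem theorem5p22 (n : nat) (alpha : seq nat) (n_gt0 : 0 < n)
    (alpha_comp : composition n alpha) (alpha_peak : peak alpha) :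
  let I0 := intL (perm_of_word n (wLT (calT'' alpha)))
                 (w1 (set_of_comp n (rev alpha))) in
  let C := classD I0 in
  let Gx := flip_diagram (scrG alpha) in
  ((forall I : {set 'S_n},
      C I <-> exists2 T : filling, ST Gx T &
                I = SigmaL (@poset_of n (flip_filling T))) /\
   is_min (@le_int n) C
     (intL (w0 (evens n (size alpha).-1))
           (perm_of_word n (wdr alpha (calT alpha)))) /\
   is_max (@le_int n) C I0) /\
  (exists f : {set 'S_n} -> filling,
     poset_iso C (@le_int n) (ST Gx) (le_ST n) f).
Proof. exact: peak_class. Qed.
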